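(* Let $\mathbb{K}\in\{\mathbb{R},\mathbb{C},\mathbb{H}\}$ and let $F$ be a $\mathbb{K}$-invariant Gårding–Dirichlet polynomial of degree $N$ on the space $\mathcal{S}_{\mathbb{K}}$ of $n\times n$ $\mathbb{K}$-Hermitian symmetric matrices. Then for every positive definite $A\in\mathcal{S}_{\mathbb{K}}$, $$F(A)^{1/N}\ \ge\ F(I)^{1/N}\,\det\nolimits_{\mathbb{K}}(A)^{1/n},$$ where $\det_{\mathbb{K}}(A)=\lambda_1(A)\cdots\lambda_n(A)$ is the product of the $n$ ($\mathbb K$-)eigenvalues of $A$.
   Context: $\mathcal S_{\mathbb R}=\mathrm{Sym}^2(\mathbb{R}^n)$ (real symmetric matrices), $\mathcal S_{\mathbb C}$ = Hermitian symmetric complex $n\times n$ matrices, $\mathcal S_{\mathbb H}$ = quaternionic Hermitian $n\times n$ matrices (equivalently, real symmetric $4n\times 4n$ matrices commuting with complex structures $I,J,K$ on $\mathbb{R}^{4n}$ satisfying the quaternion relations). Each $A\in\mathcal S_{\mathbb K}$ has $n$ real eigenvalues $\lambda_1(A),\dots,\lambda_n(A)$ counted with $\mathbb{K}$-multiplicity (in the quaternionic case each real eigenvalue of the $4n\times4n$ matrix of multiplicity $4m$ is listed $m$ times). A Gårding–Dirichlet polynomial of degree $N$ on $\mathcal S_{\mathbb K}$ is a real-valued homogeneous polynomial $F$ of degree $N$ with $F(I)>0$ such that $t\mapsto F(tI+A)$ has only real roots for every $A$ and whose Gårding cone (connected component of $\{F\ne0\}$ containing $I$) contains all positive definite $A$.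 $F$ is $\mathbb{K}$-invariant if $F(gAg^{*})=F(A)$ for all $g$ in $O(n)$, $U(n)$, or $Sp(n)\cdot Sp(1)$ respectively. *)

(* Defs.v *)
From HB Require Import structures.
From mathcomp Require Import all_boot all_order all_algebra.
From mathcomp Require Import all_classical all_reals all_analysis.
From mathcomp Require mpoly.

Set Implicit Arguments.
Unset Strict Implicit.
Unset Printing Implicit Defensive.

Import Order.TTheory GRing.Theory Num.Theory.
Import numFieldNormedType.Exports.
Local Open Scope ring_scope.
Local Open Scope classical_set_scope.

Inductive Kfield := KR | KC | KH.

Definition Kdim (K : Kfield) : nat :=
  match K with KR => 1%N | KC => 2%N | KH => 4%N end.

(* The K-structure on R^m (m = Kdim K * n): a list of orthogonal complex
   structures: none for R, one J for C, I,J,K with the quaternion relations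
   for H.  K-Hermitian matrices = real symmetric matrices commuting with them. *)
Definition Kstructure (R : realType) (K : Kfield) (m : nat)
    (Js : seq 'M[R]_m) : Prop :=
  match K with
  | KR => Js = [::]
  | KC => exists J : 'M[R]_m,
      Js = [:: J] /\ J *m J = - 1%:M /\ J^T = - J
  | KH => exists I J Kq : 'M[R]_m,
      Js = [:: I; J; Kq] /\
      I *m I = - 1%:M /\ J *m J = - 1%:M /\ Kq *m Kq = - 1%:M /\
      I *m J *m Kq = - 1%:M /\
      I^T = - I /\ J^T = - J /\ Kq^T = - Kq
  end.

Definition SK (R : realType) (m : nat) (Js : seq 'M[R]_m) (A : 'M[R]_m) : Prop :=
  A^T = A /\ (forall J, J \in Js -> A *m J = J *m A).

Definition posdef (R : realType) (m : nat) (A : 'M[R]_m) : Prop :=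
  A^T = A /\ (forall x : 'cV[R]_m, x != 0 -> 0 < (x^T *m A *m x) 0 0).

(* The group acting: O(n), U(n), Sp(n).Sp(1) respectively (realified). *)
Definition Kgroup (R : realType) (K : Kfield) (m : nat)
    (Js : seq 'M[R]_m) (g : 'M[R]_m) : Prop :=
  let compact (u : 'M[R]_m) :=
    u *m u^T = 1%:M /\ (forall J, J \in Js -> u *m J = J *m u) in
  match K with
  | KR | KC => compact g
  | KH => exists (u : 'M[R]_m) (a b c d : R),
      compact u /\ a ^+ 2 + b ^+ 2 + c ^+ 2 + d ^+ 2 = 1 /\
      g = u *m (a%:M + b *: nth 0 Js 0 + c *: nth 0 Js 1 + d *: nth 0 Js 2)
  end.

Definition Kinvariant (R : realType) (K : Kfield) (m : nat)
    (Js : seq 'M[R]_m) (F : 'M[R]_m -> R) : Prop :=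
  forall g A, Kgroup K Js g -> SK Js A -> F (g *m A *m g^T) = F A.

Definition homog_poly_on (R : realType) (m : nat) (Js : seq 'M[R]_m)
    (N : nat) (F : 'M[R]_m -> R) : Prop :=
  exists p : mpoly.mpoly (m * m) R,
    all (fun mm => mpoly.mdeg mm == N) (mpoly.msupp p) /\
    forall A, SK Js A -> F A = mpoly.meval (fun i => mxvec A 0 i) p.

Definition garding_cone (R : realType) (m : nat) (Js : seq 'M[R]_m)
    (F : 'M[R]_m -> R) : set 'M[R]_m :=
  connected_component [set A | SK Js A /\ F A != 0] 1%:M.

Definition GardingDirichlet (R : realType) (m : nat) (Js : seq 'M[R]_m)
    (N : nat) (F : 'M[R]_m -> R) : Prop :=
  [/\ homog_poly_on Js N F,
      0 < F 1%:M,
      (forall A, SK Js A -> exists (c : R) (s : seq R),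
          forall t : R, F (t%:M + A) = c * \prod_(r <- s) (t - r))
    & (forall A, SK Js A -> posdef A -> garding_cone Js F A)].

(* s is the list of the n K-eigenvalues of A (each real eigenvalue of
   algebraic multiplicity d*k listed k times, d = Kdim K) *)
Definition Keigenvalues (R : realType) (K : Kfield) (n : nat)
    (A : 'M[R]_(Kdim K * n)) (s : seq R) : Prop :=
  size s = n /\ char_poly A = (\prod_(x <- s) ('X - x%:P)) ^+ Kdim K.

(* Main.v *)
Require Import Defs.
From HB Require Import structures.
From mathcomp Require Import all_boot all_order all_algebra.
From mathcomp Require Import complex perm ring lra.
From mathcomp Require mpoly.

(* A K-Hermitian A is K-unitarily diagonal: A = sum_i mu_i P_i with K-lines P_i.
   On the span of the P_i, F becomes a homogeneous polynomial f in n real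
   variables, symmetric by K-invariance, positive on the open orthant, and
   real-rooted along (1, ..., 1).  As in Garding's theory, f(z) <> 0 as soon as
   all Re z_i > 0, because roots cannot cross the imaginary axis along the
   deformation t |-> f(e + i s y + t x), 0 <= s.  This property and positivity
   pass to derivatives D_y f with y > 0, the logarithmic derivative being a sum
   of terms 1/(-t_k) with Re t_k < 0; differentiating down to constants, all
   coefficients of f are nonnegative.  Weighted AM-GM over the monomials, averaged
   over the cyclic permutations of the variables, is the claim. *)

Set Implicit Arguments.
Unset Strict Implicit.
Unset Printing Implicit Defensive.

(** * Zero-free half-planes of real-rooted polynomials *)

Module Hurwitz.
Import Order.TTheory GRing.Theory Num.Theory.
Import mpoly.
Local Open Scope ring_scope.

(** * Evaluation along lines, top coefficients and directional derivatives *)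

Section Evaluation.
Variables (n : nat) (R : comNzRingType).
Implicit Types (f : {mpoly R[n]}).

(** Real-rootedness is assumed in the single direction (1, ..., 1), whereas nonnegative coefficients
    need control along every positive direction. Homogeneity bridges the gap: since
    [a + i y = i (y - i a)], a vector whose coordinates all have the same real part [a <> 0] is, up
    to the factor [i], a real vector shifted along (1, ..., 1) by a non-real number, and there f
    cannot vanish. This is the role of the constant e in the deformation: for purely imaginary t
    every coordinate has real part e. The top coefficient in t is f(x), independent of s, so no root
    escapes to infinity either. Nonnegative coefficients make ln f convex in the variables ln x_i;
    its tangent at (1, ..., 1) has slopes c_i of sum N. The c_i need not be equal individually,
    hence the averaging. *)

Lemma mmap_dhomog_scale (A : comNzRingType) (phi : {rmorphism R -> A})
    f N c (v : 'I_n -> A) :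
  f \is N.-homog -> mmap phi (fun i => c * v i) f = c ^+ N * mmap phi v f.
Proof.
move=> /dhomogP fN; rewrite /mmap big_distrr /=.
apply: eq_big_seq => m /fN /= <-; rewrite mulrCA; congr (_ * _).
rewrite /mmap1 mdegE -prodrXr -big_split /=.
by apply: eq_bigr => i _; rewrite exprMn.
Qed.

Lemma eq_mmap (A : comNzRingType) (phi : {rmorphism R -> A}) f (v w : 'I_n -> A) :
  v =1 w -> mmap phi v f = mmap phi w f.
Proof.
move=> vw; apply: eq_bigr => m _; congr (_ * _).
by apply: eq_bigr => i _; rewrite vw.
Qed.

Lemma rmorph_mmap (A B : comNzRingType) (phi : {rmorphism R -> A})
    (chi : {rmorphism R -> B}) (psi : {rmorphism A -> B}) f (v : 'I_n -> A) :
  (forall c, psi (phi c) = chi c) ->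
  psi (mmap phi v f) = mmap chi (psi \o v) f.
Proof.
move=> pc; rewrite /mmap rmorph_sum; apply: eq_bigr => m _ /=.
rewrite rmorphM pc; congr (_ * _).
by rewrite /mmap1 rmorph_prod; apply: eq_bigr => i _; rewrite rmorphXn.
Qed.

Variables (A : comNzRingType) (phi : {rmorphism R -> A}).

(** The target ring [A] is arbitrary: with polynomials for [A] the line itself depends on a
    parameter, as the deformation argument requires. *)
Definition line_poly (w y : 'I_n -> A) f : {poly A} :=
  mmap (polyC \o phi) (fun i => (w i)%:P + y i *: 'X) f.

Lemma horner_line_poly w y f t :
  (line_poly w y f).[t] = mmap phi (fun i => w i + t * y i) f.
Proof.
rewrite -[LHS]/(horner_eval t _) (@rmorph_mmap _ _ _ phi).
  by apply: eq_mmap => i /=; rewrite /horner_eval !hornerE mulrC.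
by move=> c /=; rewrite /horner_eval hornerC.
Qed.


(** Formal degree and top coefficient: [c] may be 0, which makes the notion multiplicative over any
    commutative ring, without integrality. *)
Definition top_coef (d : nat) (p : {poly A}) (c : A) :=
  (size p <= d.+1)%N /\ p`_d = c.

Lemma top_coefM (p q : {poly A}) a b c d :
  top_coef a p c -> top_coef b q d -> top_coef (a + b) (p * q) (c * d).
Proof.
move=> [pa <-] [qb <-]; split.
  apply: leq_trans (size_polyMleq p q) _.
  by rewrite -subn1 leq_subLR add1n -addnS -addSn leq_add.
have ab : (a < (a + b).+1)%N by rewrite ltnS leq_addr.
rewrite coefM (bigD1 (Ordinal ab)) //= addKn big1 ?addr0 // => j jE.
have [ja|aj|ja] := ltngtP j a; last by rewrite -val_eqE /= ja eqxx in jE.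
  by rewrite [q`__]nth_default ?mulr0 //; apply: leq_trans qb _; rewrite ltn_subRL ltn_add2r.
by rewrite nth_default ?mul0r //; apply: leq_trans pa _.
Qed.

Lemma top_coefX (p : {poly A}) a c k :
  top_coef a p c -> top_coef (a * k) (p ^+ k) (c ^+ k).
Proof.
move=> pa; elim: k => [|k IH]; last by rewrite !exprS mulnS; apply: top_coefM.
by rewrite muln0 !expr0; split; rewrite ?size_poly1 // coef1.
Qed.

(** The top coefficient along a line does not see the base point [w]; when it is nonzero, moving [w]
    sends no root to infinity. *)
Lemma top_coef_line (w y : 'I_n -> A) f N :
  f \is N.-homog -> top_coef N (line_poly w y f) (mmap phi y f).
Proof.
move=> /dhomogP fN; rewrite /line_poly /mmap !(big_seq _ _ _ (fun m => _ * _)).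
elim/big_rec2: _ => [|m c q /fN /= mN [qN <-]].
  by split; rewrite ?size_poly0 // coef0.
have [pN pE] : top_coef N (mmap1 (fun i => (w i)%:P + y i *: 'X) m) (mmap1 y m).
  rewrite -mN mdegE /mmap1.
  elim/big_rec3: _ => [|i c' p d _ IH]; first by split; rewrite ?size_poly1 // coef1.
  apply: top_coefM => //; rewrite -[X in top_coef X]mul1n; apply: top_coefX.
  split; last by rewrite coefD coefC coefZ coefX mulr1 add0r.
  rewrite (leq_trans (size_polyD _ _)) // geq_max (leq_trans (size_polyC_leq1 _)) //.
  by rewrite (leq_trans (size_scale_leq _ _)) // size_polyX.
split; last by rewrite coefD coefCM pE.
rewrite (leq_trans (size_polyD _ _)) // geq_max qN andbT mul_polyC.
by rewrite (leq_trans (size_scale_leq _ _)).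
Qed.

Lemma deriv_mmap (v : 'I_n -> {poly A}) f :
  (mmap (polyC \o phi) v f)^`()
    = \sum_i (v i)^`() * mmap (polyC \o phi) v (f^`M(i)).
Proof.
pose P g := (mmap (polyC \o phi) v g)^`()
    = \sum_i (v i)^`() * mmap (polyC \o phi) v (g^`M(i)).
have P1 : P 1.
  rewrite /P rmorph1 derivE big1 // => i _.
  by rewrite -mpolyC1 mderivC rmorph0 mulr0.
have PM g h : P g -> P h -> P (g * h).
  rewrite /P rmorphM derivM => -> ->; rewrite big_distrl big_distrr -big_split /=.
  by apply: eq_bigr => i _; rewrite mderivM rmorphD !rmorphM /=; ring.
have PX m : P 'X_[m].
  rewrite mpolyXE_id; apply: (big_rec P) => // i g _; apply: (PM).
  elim: (m i) => [|k IH]; rewrite ?expr0 // exprS; apply: (PM) => //.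
  rewrite /P mmapX mmap1U (bigD1 i) //= big1 => [|j ji].
    by rewrite mderivX mnm1E eqxx scale1r -{1}(add0m U_(i)%MM) addmK mmapX mmap11 mulr1 addr0.
  by rewrite mderivX mnm1E eq_sym (negPf ji) scale0r rmorph0 mulr0.
elim/mpolyind: f => [|c m g _ _ Pg]; first by
  rewrite rmorph0 deriv0 big1 // => i _; rewrite mderiv0 rmorph0 mulr0.
rewrite rmorphD derivD /= Pg mmapZ derivM derivC mul0r add0r (PX m) big_distrr -big_split.
by apply: eq_bigr => i _; rewrite mderivD mderivZ rmorphD /= mmapZ /=; ring.
Qed.

Definition dderiv (y : 'I_n -> R) f := \sum_i y i *: f^`M(i).

Lemma deriv_line_poly0 w (y : 'I_n -> R) f :
  (line_poly w (phi \o y) f)^`().[0] = mmap phi w (dderiv y f).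
Proof.
rewrite deriv_mmap /dderiv rmorph_sum horner_sum; apply: eq_bigr => i _.
rewrite /= mmapZ derivD derivC add0r derivZ derivX hornerM hornerZ hornerC mulr1.
rewrite -[mmap _ _ _]/(line_poly w (phi \o y) _) horner_line_poly; congr (_ * _).
by apply: eq_mmap => j; rewrite mul0r addr0.
Qed.

Lemma dhomog_dderiv (y : 'I_n -> R) f N : f \is N.+1.-homog -> dderiv y f \is N.-homog.
Proof.
move=> fN; rewrite rpred_sum // => i _; rewrite rpredZ //.
apply/dhomogP => m; rewrite mcoeff_msupp mcoeff_mderiv => fm.
apply/eqP; rewrite -eqSS; apply: contraNT fm => mN.
by rewrite (dhomog_nemf_coeff fN) ?mul0rn //= mdegD mdeg1 addn1.
Qed.

End Evaluation.

(** * Logarithmic derivatives and real parts *)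

Section RootsInHalfPlane.
Variable R : rcfType.
Implicit Types (z : R[i]) (s : seq R[i]).

Lemma Re_add z z' : complex.Re (z + z') = complex.Re z + complex.Re z'.
Proof. by case: z z' => [? ?] []. Qed.

Lemma Re_inv_gt0 z : 0 < complex.Re z -> 0 < complex.Re z^-1.
Proof.
case: z => a b /= a0; rewrite divr_gt0 //.
by rewrite ltr_wpDr ?sqr_ge0 // exprn_gt0.
Qed.

Lemma log_deriv_split c s :
  0 \notin s ->
  (c *: \prod_(r <- s) ('X - r%:P))^`().[0]
    = (c *: \prod_(r <- s) ('X - r%:P)).[0] * \sum_(r <- s) (- r)^-1.
Proof.
move=> s0; rewrite derivZ !hornerZ -mulrA; congr (_ * _).
elim: s s0 => [|r s IH]; first by rewrite !big_nil mulr0 derivE hornerC.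
rewrite in_cons negb_or eq_sym => /andP[r0 /IH {}IH].
rewrite !big_cons derivM derivXsubC mul1r hornerD !hornerM IH hornerXsubC sub0r.
rewrite mulrDr [in RHS]mulrAC mulfV ?oppr_eq0 // mul1r; ring.
Qed.

Lemma Re_sum_gt0 s : s != [::] -> {in s, forall r, 0 < complex.Re r} ->
  0 < complex.Re (\sum_(r <- s) r).
Proof.
case: s => // r s _; elim: s r => [|r' s IH] r pos.
  by rewrite big_seq1 pos ?mem_head.
rewrite big_cons Re_add; apply: addr_gt0; first by rewrite pos ?mem_head.
by apply: IH => t ts; rewrite pos // in_cons ts orbT.
Qed.

End RootsInHalfPlane.

(** * Stability under derivatives and nonnegativity of the coefficients *)

Section Hurwitz.
Variables (R : rcfType) (n : nat).
Implicit Types (f : {mpoly R[n]}) (z : 'I_n -> R[i]).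

Definition ceval z f : R[i] := mmap (real_complex R) z f.

Definition hurwitz f :=
  forall z, (forall i, 0 < complex.Re (z i)) -> ceval z f != 0.

Definition orthant_pos f :=
  forall x : 'I_n -> R, (forall i, 0 < x i) -> 0 < f.@[x].

Lemma ceval_real (x : 'I_n -> R) f : ceval (real_complex R \o x) f = (f.@[x])%:C%C.
Proof. by rewrite /ceval /meval [RHS](@rmorph_mmap _ _ _ _ _ (real_complex R)). Qed.

(** The ratio is given positive real part rather than merely shown to be nonzero: at real [z] this
    also yields positivity of the derivative, so one statement transmits both properties. *)
Lemma ceval_dderiv f N (y : 'I_n -> R) z :
  f \is N.+1.-homog -> hurwitz f -> orthant_pos f -> (forall i, 0 < y i) ->
  (forall i, 0 < complex.Re (z i)) ->
  exists2 w, 0 < complex.Re w & ceval z (dderiv y f) = ceval z f * w.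
Proof.
move=> fN fH fp y0 z0.
pose q := line_poly (real_complex R) z (real_complex R \o y) f.
have [s qE] := closed_field_poly_normal q.
have [qN qtop] : top_coef N.+1 q (f.@[y])%:C%C.
  by rewrite -ceval_real; apply: top_coef_line.
have q0 : q.[0] = ceval z f.
  by rewrite horner_line_poly; apply: eq_mmap => i; rewrite mul0r addr0.
have qn0 : q.[0] != 0 by rewrite q0 fH.
have sneg : {in s, forall r, complex.Re r < 0}.
  move=> r rs; rewrite ltNge; apply/negP => r0.
  have : q.[r] = 0.
    by rewrite qE hornerZ; apply/eqP; rewrite mulf_eq0 -[X in _ || X]rootE root_prod_XsubC rs orbT.
  rewrite horner_line_poly; apply/eqP; apply: fH => i.
  rewrite Re_add ltr_wpDr ?z0 //; case: r r0 {rs} => a b /= a0.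
  by rewrite mulr0 subr0 mulr_ge0 // ltW.
have s0 : 0 \notin s by apply/negP => /sneg /=; rewrite ltxx.
exists (\sum_(r <- s) (- r)^-1).
  rewrite -(big_map _ predT id); apply: Re_sum_gt0.
    (* Without roots [q] would be constant, but its coefficient of degree [N.+1] is [f.@[y]], which
       is positive. *)
    case: s qE {sneg s0} => // qE.
    have : f.@[y] != 0 by rewrite gt_eqF ?fp.
    apply: contraNneq => _; apply/eqP/(@complexI R); rewrite -qtop qE big_nil.
    by rewrite coefZ coef1 mulr0.
  move=> _ /mapP[r rs ->]; apply: Re_inv_gt0.
  by case: r rs => a b /sneg /=; rewrite oppr_gt0.
by rewrite -q0 /ceval -deriv_line_poly0 -/q qE log_deriv_split.
Qed.

Lemma linear_orthant_ge0 (b : 'I_n -> R) i :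
  (forall y, (forall j, 0 < y j) -> 0 <= \sum_j y j * b j) -> 0 <= b i.
Proof.
move=> pos; rewrite leNgt; apply/negP => bi0.
pose B := \sum_(j | j != i) b j.
have B0 : 0 < 1 + `|B| by rewrite ltr_wpDr.
(* With [y i = 1] and all other entries equal to this [d], the linear form is at most
   [b i / 2 < 0]. *)
pose d := - b i / 2 / (1 + `|B|).
have d0 : 0 < d by rewrite !divr_gt0 ?oppr_gt0.
have /pos : forall j, 0 < (if j == i then 1 else d) by move=> j; case: ifP.
rewrite (bigD1 i) //= eqxx mul1r.
rewrite (eq_bigr (fun j => d * b j)) => [|j /negPf -> //].
rewrite -mulr_sumr -/B => bB.
have := ler_wpM2l (ltW d0) (ler_norm B).
have : d * `|B| <= d * (1 + `|B|) by rewrite ler_wpM2l ?lerDr // ltW.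
rewrite [d * (1 + _)]divfK ?gt_eqF //; lra.
Qed.

Lemma hurwitz_coef_ge0 N f m :
  f \is N.-homog -> hurwitz f -> orthant_pos f -> 0 <= f@_m.
Proof.
elim: N f m => [|N IH] f m fN fH fp.
  have fC : f = (f@_0)%:MP.
    apply/mpolyP => k; rewrite mcoeffC.
    have [->|k0] := eqVneq k 0%MM; first by rewrite mulr1.
    by rewrite mulr0 (dhomog_nemf_coeff fN) //= mdeg_eq0.
  have := fp (fun _ => 1) (fun _ => ltr01); rewrite fC mevalC mcoeffC => c0.
  by rewrite mulr_ge0 ?ler0n // ltW.
have [mN|mN] := eqVneq (mdeg m) N.+1; last by rewrite (dhomog_nemf_coeff fN).
have [i mi] : exists i, (0 < m i)%N.
  apply/existsP; apply: contra_eqT mN => /existsPn m0.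
  by rewrite mdegE big1 // => i _; have := m0 i; rewrite -eqn0Ngt => /eqP.
have mE : m = (m - U_(i) + U_(i))%MM.
  rewrite submK //; apply/mnm_lepP => j; rewrite mnm1E.
  by case: eqVneq => // <-.
set k := (m - U_(i))%MM in mE.
(* [D_y f] has nonnegative coefficients for all [y > 0]; let [y] tend to [e_i]. *)
suff : 0 <= f@_(k + U_(i)) *+ (k i).+1 by rewrite -mE pmulrn_lge0.
apply: (@linear_orthant_ge0 (fun j => f@_(k + U_(j)) *+ (k j).+1)) => y y0.
suff : 0 <= (dderiv y f)@_k.
  rewrite [X in 0 <= X -> _]raddf_sum /=; congr (0 <= _).
  by apply: eq_bigr => j _; rewrite mcoeffZ mcoeff_mderiv.
apply: IH; first exact: dhomog_dderiv.
  move=> z z0; have [w w0 ->] := ceval_dderiv fN fH fp y0 z0.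
  rewrite mulf_neq0 ?fH //; apply: contraTneq w0 => ->; by rewrite ltxx.
move=> x x0; have [|w w0] := ceval_dderiv fN fH fp y0 (z := real_complex R \o x).
  by [].
rewrite !ceval_real; case: w w0 => a b /= a0 [-> _].
by rewrite mul0r subr0 mulr_gt0 ?fp.
Qed.

End Hurwitz.

(** * Roots of a complex polynomial under small perturbations of its coefficients *)

Section RootContinuity.
Variable R : rcfType.
Local Notation C := R[i].
Local Notation nc := (@Normc.normc R).

Lemma nc_add (z w : C) : nc (z + w) <= nc z + nc w.
Proof. exact: le_normcD. Qed.

Lemma nc_opp (z : C) : nc (- z) = nc z.
Proof. exact: normcN. Qed.

Lemma nc_ge0 (z : C) : 0 <= nc z.
Proof. by case: z => a b; rewrite sqrtr_ge0. Qed.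

Lemma nc_ge_Re (z : C) : complex.Re z <= nc z.
Proof.
case: z => a b /=; apply: le_trans (ler_norm a) _.
by rewrite -sqrtr_sqr ler_sqrt ?lerDl ?sqr_ge0 // addr_ge0 ?sqr_ge0.
Qed.

Lemma nc_gt0 (z : C) : (0 < nc z) = (z != 0).
Proof.
rewrite lt_def nc_ge0 andbT; congr (~~ _).
apply/eqP/eqP => [/Normc.eq0_normc //|->]; exact: Normc.normc0.
Qed.

Lemma ncX (z : C) k : nc (z ^+ k) = nc z ^+ k.
Proof.
elim: k => [|k IH]; first by rewrite !expr0 Normc.normc1.
by rewrite !exprS Normc.normcM IH.
Qed.

Lemma nc_sum (I : Type) (r : seq I) (F : I -> C) :
  nc (\sum_(i <- r) F i) <= \sum_(i <- r) nc (F i).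
Proof.
elim/big_rec2: _ => [|i b a _ ab]; first by rewrite Normc.normc0.
by apply: le_trans (nc_add _ _) _; rewrite lerD2l.
Qed.

Lemma horner_locally_bounded (p : {poly C}) (z0 : C) :
  exists2 M, 0 < M & forall z, nc (z - z0) <= 1 -> nc p.[z] <= M.
Proof.
elim/poly_ind: p => [|p c [M M0 pM]].
  by exists 1 => // z _; rewrite horner0 Normc.normc0.
have z1 := nc_ge0 z0; have c1 := nc_ge0 c.
exists (M * (1 + nc z0) + nc c); first by rewrite ltr_wpDr // mulr_gt0 // ltr_wpDr.
move=> z zz; rewrite !hornerE; apply: le_trans (nc_add _ _) _.
rewrite lerD2r Normc.normcM ler_pM ?nc_ge0 ?pM //.
by rewrite -(subrK z0 z) (le_trans (nc_add _ _)) // lerD2r.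
Qed.

(** Factor [p - p.[z0]%:P] by ['X - z0%:P] and bound the quotient on the unit disc around [z0]. *)
Lemma horner_continuous (p : {poly C}) (z0 : C) e : 0 < e ->
  exists2 d, 0 < d & forall z, nc (z - z0) < d -> nc (p.[z] - p.[z0]) <= e.
Proof.
move=> e0; have /factor_theorem[q qE] : root (p - p.[z0]%:P) z0.
  by rewrite /root !hornerE subrr.
have [M M0 qM] := horner_locally_bounded q z0.
exists (Num.min 1 (e / M)) => [|z]; first by rewrite lt_min ltr01 divr_gt0.
rewrite lt_min => /andP[z1 zM].
have -> : p.[z] - p.[z0] = q.[z] * (z - z0).
  by have := congr1 (fun r : {poly C} => r.[z]) qE; rewrite !hornerE.
rewrite Normc.normcM -(divfK (lt0r_neq0 M0) e) [e / M * M]mulrC.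
by rewrite ler_pM ?nc_ge0 ?qM // ltW.
Qed.

Lemma coef_continuous (Q : {poly {poly C}}) (z0 : C) N e : 0 < e ->
  exists2 d, 0 < d & forall z, nc (z - z0) < d ->
    forall k, (k <= N)%N -> nc ((Q`_k).[z] - (Q`_k).[z0]) <= e.
Proof.
move=> e0; elim: N => [|N [d d0 dP]].
  have [d d0 dP] := horner_continuous Q`_0 z0 e0; exists d => // z zd [] // _.
  exact: dP.
have [d' d0' dP'] := horner_continuous Q`_N.+1 z0 e0.
exists (Num.min d d') => [|z]; first by rewrite lt_min d0.
rewrite lt_min => /andP[zd zd'] k; rewrite leq_eqVlt => /orP[/eqP->|].
  exact: dP'.
by rewrite ltnS; apply: dP.
Qed.

Lemma horner_perturb (p q : {poly C}) N e (t : C) :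
  (size p <= N.+1)%N -> (size q <= N.+1)%N ->
  (forall k, (k <= N)%N -> nc (p`_k - q`_k) <= e) ->
  nc (p.[t] - q.[t]) <= N.+1%:R * e * (1 + nc t) ^+ N.
Proof.
move=> pN qN pq; rewrite (horner_coef_wide _ pN) (horner_coef_wide _ qN).
rewrite -sumrB; apply: le_trans (nc_sum _ _) _.
rewrite -mulrA mulr_natl -[X in _ *+ X]card_ord -sumr_const ler_sum // => k _.
have kN : (k <= N)%N by rewrite -ltnS.
rewrite -mulrBl Normc.normcM ler_pM ?nc_ge0 ?pq // ncX.
have t1 : 1 <= 1 + nc t by rewrite lerDl nc_ge0.
apply: (@le_trans _ _ ((1 + nc t) ^+ k)).
  by rewrite lerXn2r ?nnegrE ?nc_ge0 ?addr_ge0 ?nc_ge0 ?lerDr.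
by rewrite ler_weXn2l.
Qed.

Lemma split_lower_bound (s : seq C) : {in s, forall r, complex.Re r < 0} ->
  exists2 h, 0 < h & forall t, 0 <= complex.Re t ->
    h * (1 + nc t) ^+ size s <= nc (\prod_(r <- s) ('X - r%:P)).[t].
Proof.
elim: s => [|r s IH] sneg.
  by exists 1 => // t _; rewrite big_nil hornerC Normc.normc1 mulr1.
have [t ts|h h0 hP] := IH; first by rewrite sneg // in_cons ts orbT.
pose a := - complex.Re r.
have a0 : 0 < a by rewrite oppr_gt0 sneg ?mem_head.
have r0 := nc_ge0 r.
(* Since [a <= nc (t - r)], one gets [1 + nc t <= nc (t - r) + (1 + nc r) <= k * nc (t - r)]. *)
pose k := 1 + (1 + nc r) / a.
have k0 : 0 < k by rewrite ltr_wpDr // divr_ge0 ?addr_ge0 // ltW.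
exists (k^-1 * h) => [|t t0]; first by rewrite mulr_gt0 ?invr_gt0.
rewrite big_cons hornerM Normc.normcM exprS mulrACA.
apply: ler_pM; rewrite ?hP //.
- by apply: mulr_ge0; [rewrite invr_ge0 ltW | rewrite addr_ge0 ?nc_ge0].
- by apply: mulr_ge0; [exact: ltW | rewrite exprn_ge0 // addr_ge0 ?nc_ge0].
rewrite hornerXsubC mulrC ler_pdivrMr // /k mulrDr mulr1.
have tr : nc t <= nc (t - r) + nc r.
  by rewrite -{1}(subrK r t) nc_add.
have ta : a <= nc (t - r).
  apply: le_trans (nc_ge_Re _); rewrite Re_add /a.
  by case: (r) => ? ?; rewrite /= lerDr.
have : (1 + nc r) <= nc (t - r) * ((1 + nc r) / a).
  by rewrite mulrCA mulrA -mulrA ler_peMr ?addr_ge0 // ler_pdivlMr // mul1r.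
lra.
Qed.

(* The closed right half-plane: for polynomials without purely imaginary roots,
   this is an open and closed condition. *)
Definition stable (q : {poly C}) := forall t, 0 <= complex.Re t -> q.[t] != 0.

Lemma top_coef_split (q : {poly C}) N a : top_coef N q a -> a != 0 ->
  exists2 s, size s = N & q = a *: \prod_(r <- s) ('X - r%:P).
Proof.
move=> [qN qa] a0; have sq : size q = N.+1.
  apply/eqP; rewrite eqn_leq qN ltnNge; apply: contra a0 => sN.
  by rewrite -qa nth_default.
have [s qE] := closed_field_poly_normal q.
exists s; last by rewrite {1}qE lead_coefE sq qa.
have := sq; rewrite qE size_scale ?size_prod_XsubC; first by case.
by rewrite lead_coef_eq0 -size_poly_eq0 sq.
Qed.

(** In [Q] the outer variable is the unknown [t], the inner one the deformation parameter [s]. The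
    constant top coefficient rules out escape to infinity, and the third hypothesis rules out
    crossing the axis. Instead of following individual roots, the proof compares values of the two
    polynomials in the half-plane. *)
Lemma stable_locally_constant (Q : {poly {poly C}}) N (a : C) (s0 : R) :
  a != 0 -> (forall s : R, top_coef N (map_poly (horner_eval s%:C%C) Q) a) ->
  (forall (s : R) t, complex.Re t = 0 -> (map_poly (horner_eval s%:C%C) Q).[t] != 0) ->
  exists2 d, 0 < d & forall s : R, `|s - s0| < d ->
    stable (map_poly (horner_eval s%:C%C) Q)
    <-> stable (map_poly (horner_eval s0%:C%C) Q).
Proof.
move=> a0 Qtop Qim; pose q (s : R) := map_poly (horner_eval s%:C%C) Q.
have a1 : 0 < nc a by rewrite nc_gt0.
have near e : 0 < e -> exists2 d, 0 < d & forall s t, `|s - s0| < d ->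
    nc ((q s).[t] - (q s0).[t]) <= N.+1%:R * e * (1 + nc t) ^+ N.
  move=> e0; have [d d0 dP] := coef_continuous Q s0%:C%C N e0.
  exists d => // s t sd; apply: horner_perturb => [||k kN].
  - by case: (Qtop s).
  - by case: (Qtop s0).
  rewrite /q !coef_map; apply: dP => //.
  by rewrite -rmorphB /= expr0n addr0 sqrtr_sqr.
have split s : exists2 r, size r = N & q s = a *: \prod_(x <- r) ('X - x%:P).
  exact: top_coef_split (Qtop s) a0.
have stableP s r : q s = a *: \prod_(x <- r) ('X - x%:P) -> stable (q s) ->
    {in r, forall x, complex.Re x < 0}.
  move=> qE st x xr; rewrite ltNge; apply/negP => /st.
  by rewrite qE hornerZ mulf_eq0 negb_or -rootE root_prod_XsubC xr andbF.
have N0 : 0 < N.+2%:R :> R by rewrite ltr0Sn.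
have N1 : N.+1%:R < N.+2%:R :> R by rewrite ltr_nat.
have [r rN qE] := split s0.
have [/allP sneg|] := boolP (all (fun x => complex.Re x < 0) r).
  (* [|q s0| >= h (1 + |t|)^N] on the half-plane, uniformly in the unbounded [t],
     while [q s - q s0] has degree at most [N] and small coefficients. *)
  have [h h0 hP] := split_lower_bound sneg.
  have st : stable (q s0).
    move=> t t0; rewrite qE hornerZ; apply: mulf_neq0 => //.
    by rewrite -rootE root_prod_XsubC; apply: contraTN t0 => /sneg; rewrite -ltNge.
  (* The divisor [N.+2] outweighs the factor [N.+1] in [near], which makes the final inequality
     strict. *)
  have e0 : 0 < nc a * h / N.+2%:R by rewrite !divr_gt0 ?mulr_gt0.
  have [d d0 dP] := near _ e0; exists d => // s sd; split => // _ t t0.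
  apply/eqP => qst; have := dP s t sd; rewrite qst sub0r nc_opp.
  apply/negP; rewrite -ltNge qE hornerZ Normc.normcM.
  apply: lt_le_trans (ler_wpM2l (ltW a1) (hP _ t0)).
  rewrite rN [X in _ < X]mulrA ltr_pM2r ?exprn_gt0 ?ltr_wpDr ?nc_ge0 //.
  by rewrite mulrCA gtr_pMr ?mulr_gt0 // ltr_pdivrMr // mul1r.
case/allPn => t0 t0r; rewrite -leNgt => t0ge.
have qt0 : (q s0).[t0] = 0.
  by rewrite qE hornerZ; apply/eqP; rewrite mulf_eq0 -[X in _ || X]rootE root_prod_XsubC t0r orbT.
have t0gt : 0 < complex.Re t0.
  rewrite lt_def t0ge andbT; apply/eqP => /(Qim s0); by rewrite -/(q s0) qt0 eqxx.
have t1 : 0 < (1 + nc t0) ^+ N by rewrite exprn_gt0 // ltr_wpDr ?nc_ge0.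
(* Chosen so that [near] at [t0] gives a bound strictly below [nc a * complex.Re t0 ^+ N]. *)
have e0 : 0 < nc a * complex.Re t0 ^+ N / (1 + nc t0) ^+ N / N.+2%:R.
  by rewrite !divr_gt0 ?t1 ?mulr_gt0 ?exprn_gt0.
have [d d0 dP] := near _ e0; exists d => // s sd; split => st; last first.
  by have := st _ t0ge; rewrite -/(q s0) qt0 eqxx.
(* A stable [q s] satisfies [|q s| >= |a| (Re t0)^N] at [t0], but [q s0] vanishes there. *)
exfalso; have [r' rN' qE'] := split s.
have sneg := stableP _ _ qE' st.
have := dP s t0 sd; rewrite qt0 subr0.
have -> : N.+1%:R * (nc a * complex.Re t0 ^+ N / (1 + nc t0) ^+ N / N.+2%:R)
    * (1 + nc t0) ^+ N = nc a * complex.Re t0 ^+ N * (N.+1%:R / N.+2%:R).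
  have canc (x y z w : R) : y != 0 -> x * (z / y / w) * y = z * (x / w).
    by move=> y0; rewrite [z / y / w]mulrAC -mulrA divfK // mulrCA.
  by rewrite canc // lt0r_neq0.
move=> upper; have : nc (q s).[t0] < nc a * complex.Re t0 ^+ N.
  apply: le_lt_trans upper _.
  by rewrite gtr_pMr ?mulr_gt0 ?exprn_gt0 // ltr_pdivrMr // mul1r.
apply/negP; rewrite -leNgt qE' hornerZ Normc.normcM ler_pM2l // -rN'.
elim: (r') sneg => [|x l IH] sneg; first by rewrite big_nil hornerC Normc.normc1.
rewrite big_cons hornerM Normc.normcM exprS ler_pM ?exprn_ge0 //; last first.
  by apply: IH => y yl; rewrite sneg // in_cons yl orbT.
rewrite hornerXsubC; apply: le_trans (nc_ge_Re _); rewrite Re_add lerDl.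
by case: x sneg => b c /(_ _ (mem_head _ _)) /=; rewrite oppr_ge0 => /ltW.
Qed.

End RootContinuity.

(** * From real-rootedness in one direction to the half-plane property *)

Lemma map_line_poly (n : nat) (R A B : comNzRingType) (phi : {rmorphism R -> A})
    (chi : {rmorphism R -> B}) (psi : {rmorphism A -> B}) (w y : 'I_n -> A)
    (f : {mpoly R[n]}) : (forall c, psi (phi c) = chi c) ->
  map_poly psi (line_poly phi w y f) = line_poly chi (psi \o w) (psi \o y) f.
Proof.
move=> pc; rewrite /line_poly (@rmorph_mmap _ _ _ _ _ (polyC \o chi)).
  by apply: eq_mmap => i /=; rewrite rmorphD /= map_polyC map_polyZ map_polyX.
by move=> c /=; rewrite map_polyC /= pc.
Qed.

(** In characteristic zero the naturals supply more roots of [p - q] than its degree allows. *)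
Lemma eq_horner_poly (R : numDomainType) (p q : {poly R}) :
  (forall t, p.[t] = q.[t]) -> p = q.
Proof.
move=> pq; apply/eqP; rewrite -subr_eq0; apply/eqP.
apply: (@roots_geq_poly_eq0 _ _ [seq k%:R | k <- iota 0 (size (p - q))]).
- by apply/allP => _ /mapP[k _ ->]; rewrite /root !hornerE pq subrr.
- rewrite map_inj_uniq ?iota_uniq // => i j /eqP.
  by rewrite eqr_nat => /eqP.
- by rewrite size_map size_iota.
Qed.

Section RealRooted.
Variables (R : rcfType) (n : nat) (f : {mpoly R[n]}) (N : nat).
(* Connectedness of the line: the only place where completeness of [R] enters. *)
Hypothesis connR : forall P : R -> Prop,
  (forall s0, exists2 d, 0 < d & forall s, `|s - s0| < d -> (P s <-> P s0)) ->
  forall a b, P a -> P b.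
Hypothesis fN : f \is N.-homog.
Hypothesis fpos : orthant_pos f.
Hypothesis froot : forall x : 'I_n -> R, exists (c : R) (s : seq R),
  forall t, f.@[fun i => t + x i] = c * \prod_(r <- s) (t - r).
Local Notation rc := (real_complex R).

Lemma ceval_shift_neq0 (x : 'I_n -> R) (t : R[i]) :
  complex.Im t != 0 -> ceval (fun i => (x i)%:C%C + t) f != 0.
Proof.
move=> t0; have [c [s fE]] := froot x.
pose p := line_poly idfun x (fun=> 1) f.
have pE : p = c *: \prod_(r <- s) ('X - r%:P).
  apply: eq_horner_poly => u; rewrite horner_line_poly hornerZ horner_prod.
  under eq_bigr do rewrite hornerXsubC.
  by rewrite -fE; apply: eq_mmap => i; rewrite mulr1 addrC.
(* [froot] alone allows [c = 0], but the coefficient of degree [N] in [p] is the positive value of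
   [f] at (1, ..., 1). *)
have c0 : c != 0.
  have /gt_eqF/negbT : 0 < f.@[fun=> 1] by apply: fpos => _; exact: ltr01.
  apply: contraNneq => c0; have [_ pN] := @top_coef_line _ _ _ idfun x (fun=> 1) _ _ fN.
  by rewrite /meval -pN -/p pE c0 scale0r coef0.
have -> : ceval (fun i => (x i)%:C%C + t) f = (map_poly rc p).[t].
  rewrite (@map_line_poly _ _ _ _ _ rc) // horner_line_poly.
  by apply: eq_mmap => i /=; rewrite mulr1.
rewrite pE map_polyZ hornerZ /= mulf_neq0 //.
  by apply: contraNneq c0 => /(@complexI R) ->.
rewrite rmorph_prod horner_prod prodf_seq_neq0; apply/allP => r _.
rewrite /= map_polyXsubC hornerXsubC subr_eq0; apply: contraNneq t0 => ->; exact: eqxx.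
Qed.

Lemma ceval_const_Re_neq0 (a : R) (y : 'I_n -> R) :
  a != 0 -> ceval (fun i => (a +i* y i)%C) f != 0.
Proof.
move=> a0; have -> : ceval (fun i => (a +i* y i)%C) f
    = 'i%C ^+ N * ceval (fun i => (y i)%:C%C + (0 -i* a)%C) f.
  rewrite /ceval -mmap_dhomog_scale //; apply: eq_mmap => i.
  by apply/eqP; rewrite eq_complex /=; apply/andP; split; apply/eqP; ring.
by rewrite mulf_neq0 ?ceval_shift_neq0 ?oppr_eq0 // expf_neq0 // eq_complex /= oner_eq0 andbF.
Qed.

(** The start [s = 0] of the deformation. For real [t] this is positivity; otherwise
    [e + t x = t (x + e / t)], where [e / t] is a non-real shift. *)
Lemma ceval_pos_line_neq0 (e : R) (x : 'I_n -> R) (t : R[i]) :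
  0 < e -> (forall i, 0 < x i) -> 0 <= complex.Re t ->
  ceval (fun i => e%:C%C + t * (x i)%:C%C) f != 0.
Proof.
move=> e0 x0 t0; have [ti|ti] := eqVneq (complex.Im t) 0.
  have -> : ceval (fun i => e%:C%C + t * (x i)%:C%C) f
      = ceval (rc \o (fun i => e + complex.Re t * x i)) f.
    apply: eq_mmap => i; case: t ti {t0} => a b /= ->.
    by apply/eqP; rewrite eq_complex /=; apply/andP; split; apply/eqP; ring.
  rewrite ceval_real; have /gt_eqF/negbT : 0 < f.@[fun i => e + complex.Re t * x i].
    by apply: fpos => i; rewrite ltr_wpDr // mulr_ge0 // ltW.
  by apply: contraNneq => /(@complexI R) ->.
have tn0 : t != 0 by apply: contraNneq ti => ->.
have -> : ceval (fun i => e%:C%C + t * (x i)%:C%C) f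
    = t ^+ N * ceval (fun i => (x i)%:C%C + e%:C%C / t) f.
  rewrite /ceval -mmap_dhomog_scale //; apply: eq_mmap => i.
  by rewrite mulrDr [t * (_ / _)]mulrCA mulfV // mulr1 addrC.
rewrite mulf_neq0 ?expf_neq0 // ceval_shift_neq0 //.
case: t ti {t0 tn0} => a b /= b0; rewrite mul0r addr0.
apply: mulf_neq0; first exact: lt0r_neq0.
rewrite oppr_eq0; apply: mulf_neq0 => //; rewrite invr_eq0 lt0r_neq0 //.
by rewrite ltr_wpDl ?sqr_ge0 // lt_def sqrf_eq0 b0 sqr_ge0.
Qed.

Lemma exists_lower (x : 'I_n -> R) : (forall i, 0 < x i) ->
  exists2 e, 0 < e & forall i, e < x i.
Proof.
move=> x0; have s0 (P : pred 'I_n) : 0 <= \sum_(j | P j) (x j)^-1.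
  by rewrite sumr_ge0 // => j _; rewrite invr_ge0 ltW.
have e0 : 0 < 1 + \sum_j (x j)^-1 by rewrite ltr_wpDr.
(* The inverse of this witness exceeds every [(x i)^-1]; the summand 1 makes this strict and covers
   [n = 0]. *)
exists (1 + \sum_j (x j)^-1)^-1 => [|i]; first by rewrite invr_gt0.
rewrite -[ltRHS]invrK ltf_pV2 ?posrE ?invr_gt0 // (bigD1 i) //= addrCA ltrDl.
by rewrite ltr_wpDr.
Qed.

Theorem real_rooted_hurwitz : hurwitz f.
Proof.
move=> z z0; have [e e0 ez] := exists_lower z0.
(* Splitting [e] off the real parts keeps [x] positive, and [e + i s y + t x] recovers [z] at
   [s = t = 1]. *)
pose y i := complex.Im (z i); pose x i := complex.Re (z i) - e.
have x0 i : 0 < x i by rewrite subr_gt0.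
pose Q : {poly {poly R[i]}} := line_poly (polyC \o rc)
  (fun i => (e%:C%C)%:P + (0 +i* y i)%C *: 'X) (fun i => ((x i)%:C%C)%:P) f.
have QE (s : R) : map_poly (horner_eval s%:C%C) Q
    = line_poly rc (fun i => (e +i* (s * y i))%C) (fun i => (x i)%:C%C) f.
  rewrite (@map_line_poly _ _ _ _ _ rc); last first.
    by move=> c; rewrite /= /horner_eval hornerC.
  apply: eq_mmap => i; rewrite /= /horner_eval !hornerE; congr (_%:P + _).
  by apply/eqP; rewrite eq_complex /=; apply/andP; split; apply/eqP; ring.
have Qt (s : R) t : (map_poly (horner_eval s%:C%C) Q).[t]
    = ceval (fun i => (e +i* (s * y i))%C + t * (x i)%:C%C) f.
  by rewrite QE horner_line_poly.
have fx : (f.@[x])%:C%C != 0.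
  have /gt_eqF/negbT := fpos x0; apply: contraNneq => /(@complexI R) ->; exact: eqxx.
have Qtop (s : R) : top_coef N (map_poly (horner_eval s%:C%C) Q) (f.@[x])%:C%C.
  by rewrite QE -ceval_real; apply: top_coef_line.
have Qim (s : R) t : complex.Re t = 0 -> (map_poly (horner_eval s%:C%C) Q).[t] != 0.
  move=> t0; rewrite Qt; suff -> : ceval (fun i => (e +i* (s * y i))%C + t * (x i)%:C%C) f
      = ceval (fun i => (e +i* (s * y i + complex.Im t * x i))%C) f.
    by apply: ceval_const_Re_neq0; rewrite lt0r_neq0.
  apply: eq_mmap => i; case: t t0 => a' b' /= ->.
  by apply/eqP; rewrite eq_complex /=; apply/andP; split; apply/eqP; ring.
have stab a b : stable (map_poly (horner_eval a%:C%C) Q) ->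
    stable (map_poly (horner_eval b%:C%C) Q).
  apply: (connR (P := fun s : R => stable (map_poly (horner_eval s%:C%C) Q))) => s0.
  exact: stable_locally_constant fx Qtop Qim.
have st0 : stable (map_poly (horner_eval 0%:C%C) Q).
  move=> t t0; rewrite Qt.
  suff -> : ceval (fun i => (e +i* (0 * y i))%C + t * (x i)%:C%C) f
      = ceval (fun i => e%:C%C + t * (x i)%:C%C) f by apply: ceval_pos_line_neq0.
  by apply: eq_mmap => i; rewrite mul0r.
have := stab 0 1 st0 1 ler01; rewrite Qt.
suff -> : ceval (fun i => (e +i* (1 * y i))%C + 1 * (x i)%:C%C) f = ceval z f by [].
apply: eq_mmap => i; rewrite mul1r /x /y; case: (z i) => a b.
by apply/eqP; rewrite eq_complex /=; apply/andP; split; apply/eqP; ring.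
Qed.

End RealRooted.

(** The anonymous index type hides the multinomials: what follows needs only a finite sum of
    monomials with nonnegative weights and total exponent [N]. *)
Theorem real_rooted_monomials (R : rcfType) n (f : {mpoly R[n]}) N :
  (forall P : R -> Prop,
    (forall s0, exists2 d, 0 < d & forall s, `|s - s0| < d -> (P s <-> P s0)) ->
    forall a b, P a -> P b) ->
  f \is N.-homog -> orthant_pos f ->
  (forall x : 'I_n -> R, exists (c : R) (s : seq R),
    forall t, f.@[fun i => t + x i] = c * \prod_(r <- s) (t - r)) ->
  exists (I : eqType) (s : seq I) (a : I -> R) (e : I -> 'I_n -> nat),
    (forall x, f.@[x] = \sum_(m <- s) a m * \prod_i x i ^+ e m i) /\
    {in s, forall m, 0 <= a m /\ (\sum_i e m i)%N = N}.
Proof.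
move=> connR fN fpos froot.
exists 'X_{1..n}, (msupp f), (fun m => f@_m), (fun (m : 'X_{1..n}) i => m i); split=> [x|m mf].
  exact: mevalE.
split.
  exact: (hurwitz_coef_ge0 m fN (real_rooted_hurwitz connR fN fpos froot) fpos).
by rewrite -mdegE; exact: (dhomogP _ _ _ fN _ mf).
Qed.

Lemma linear_substitution (R : comNzRingType) n k N (p : {mpoly R[k]})
    (L : 'I_k -> 'I_n -> R) : all (fun m => mdeg m == N) (msupp p) ->
  exists2 f : {mpoly R[n]}, f \is N.-homog &
    forall x, f.@[x] = p.@[fun j => \sum_i x i * L j i].
Proof.
move=> pN; pose l j : {mpoly R[n]} := \sum_i L j i *: 'X_i.
have l1 j : l j \is 1.-homog.
  by rewrite rpred_sum // => i _; rewrite rpredZ // dhomogX /= mdeg1.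
exists (mmap (@mpolyC n R) l p) => [|x].
  rewrite /mmap big_seq rpred_sum // => m /(allP pN)/eqP /= <-.
  rewrite mul_mpolyC rpredZ // mdegE /mmap1.
  elim/big_rec2: _ => [|j q d _ qd]; first exact: dhomog1.
  by rewrite dhomogM // -[X in X.-homog]mul1n dhomogMn.
rewrite /meval (@rmorph_mmap _ _ _ _ (@mpolyC n R) idfun (meval x)) => [|c]; last exact: mevalC.
apply: eq_mmap => j; rewrite /= /l raddf_sum; apply: eq_bigr => i _ /=.
by rewrite mevalZ mevalXU mulrC.
Qed.

End Hurwitz.

From mathcomp Require Import all_classical all_reals all_analysis.
Import Order.TTheory GRing.Theory Num.Theory.
Import numFieldNormedType.Exports.
Local Open Scope ring_scope.

(** * Diagonalization over K *)

Lemma mxtrace_tr_mul_eq0 (R : realDomainType) m (B : 'M[R]_m) :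
  \tr (B^T *m B) = 0 -> B = 0.
Proof.
have sq0 i : 0 <= \sum_j B j i ^+ 2 by rewrite sumr_ge0 // => j _; rewrite sqr_ge0.
have -> : \tr (B^T *m B) = \sum_i \sum_j B j i ^+ 2.
  by apply: eq_bigr => i _; rewrite !mxE; apply: eq_bigr => j _; rewrite mxE expr2.
move=> /eqP; rewrite psumr_eq0 // => /allP B0; apply/matrixP => j i.
have := B0 i (mem_index_enum _); rewrite /= psumr_eq0 => [/allP|j' _]; last exact: sqr_ge0.
by move=> /(_ j (mem_index_enum _)); rewrite /= sqrf_eq0 mxE => /eqP.
Qed.

(** Apply the factors [A - x] of the characteristic polynomial to [w] one by one. The full product
    kills [w] by Cayley-Hamilton, and the last nonzero vector before that is an eigenvector, still
    in [P]. *)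
Lemma eigenvector_in_stable (R : fieldType) m (A : 'M[R]_m)
    (P : 'cV[R]_m -> Prop) (s : seq R) (w : 'cV[R]_m) :
  char_poly A = \prod_(x <- s) ('X - x%:P) ->
  (forall x v, P v -> P (A *m v - x *: v)) -> P w -> w != 0 ->
  exists (v : 'cV[R]_m) (x : R), [/\ P v, v != 0 & A *m v = x *: v].
Proof.
case: m A P w => [|m] A P w charA stabP Pw w0.
  by rewrite (flatmx0 w) eqxx in w0.
have {charA} : horner_mx A (\prod_(x <- s) ('X - x%:P)) *m w = 0.
  by rewrite -charA Cayley_Hamilton mul0mx.
elim: s w Pw w0 => [|x s IH] w Pw w0.
  by rewrite big_nil rmorph1 mul1mx => w00; rewrite w00 eqxx in w0.
rewrite big_cons mulrC rmorphM /= rmorphB /= horner_mx_X horner_mx_C -mulmxA.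
rewrite mulmxBl mul_scalar_mx; have [Aw _|Aw] := eqVneq (A *m w - x *: w) 0.
  by exists w, x; split => //; apply/eqP; rewrite -subr_eq0 Aw.
by apply: IH => //; apply: stabP.
Qed.

Lemma prod_flatten_nseq (R : comNzRingType) (I : Type) d (s : seq I) (F : I -> R) :
  \prod_(x <- flatten (nseq d s)) F x = (\prod_(x <- s) F x) ^+ d.
Proof.
elim: d => [|d IH]; first by rewrite big_nil.
by rewrite /= big_cat IH exprS.
Qed.

(** * K-orthonormal frames and their matrix units *)

Section Frame.
Variables (R : rcfType) (d m : nat) (T : 'I_d -> 'M[R]_m).

(* [T] lists the identity and the complex structures; [twist] averages a matrix
   into one commuting with all of them, so that [munit v i l] below are the matrix
   units of the K-frame [v] and [munit v i i] projects onto the K-line of [v i]. *)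
Definition twist (X : 'M[R]_m) : 'M[R]_m := \sum_j T j *m X *m (T j)^T.

Hypothesis Torth : forall j, (T j)^T *m T j = 1%:M.
Hypothesis Tskew : forall j k, j != k -> ((T j)^T *m T k)^T = - ((T j)^T *m T k).
Hypothesis Ttwist : forall k X, T k *m twist X = twist X *m T k.

Lemma tr_twist X : (twist X)^T = twist X^T.
Proof.
rewrite raddf_sum; apply: eq_bigr => j _.
by rewrite /= !trmx_mul trmxK mulmxA.
Qed.

Definition orthoframe (I : finType) (v : I -> 'cV[R]_m) :=
  forall i l j k, (T j *m v i)^T *m (T k *m v l) = ((i == l) && (j == k))%:R%:M.

Section OrthoFrame.
Variables (I : finType) (v : I -> 'cV[R]_m).
Hypothesis vP : orthoframe v.

Definition munit i l := twist (v i *m (v l)^T).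

Lemma tr_munit i l : (munit i l)^T = munit l i.
Proof. by rewrite tr_twist trmx_mul trmxK. Qed.

Lemma munit_commute i l k : T k *m munit i l = munit i l *m T k.
Proof. exact: Ttwist. Qed.

Lemma munit_frame i l k a : munit i l *m (T k *m v a) = (l == a)%:R *: (T k *m v i).
Proof.
have summand j : T j *m (v i *m (v l)^T) *m (T j)^T *m (T k *m v a)
    = ((l == a) && (j == k))%:R *: (T j *m v i).
  transitivity (T j *m v i *m ((T j *m v l)^T *m (T k *m v a))).
    by rewrite trmx_mul !mulmxA.
  by rewrite vP mul_mx_scalar.
rewrite mulmx_suml (bigD1 k) //= big1 ?addr0 => [|j jk].
  by rewrite summand eqxx andbT.
by rewrite summand (negPf jk) andbF scale0r.
Qed.

Lemma munitM i l a b : munit i l *m munit a b = (l == a)%:R *: munit i b.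
Proof.
rewrite [munit a b]/munit [munit i b]/munit /twist mulmx_sumr scaler_sumr.
apply: eq_bigr => k _; rewrite !mulmxA -[_ *m T k *m _]mulmxA munit_frame.
by rewrite -!scalemxAl.
Qed.

Lemma trace_munit i : \tr (munit i i) = d%:R.
Proof.
rewrite raddf_sum -[d in RHS]card_ord -sumr_const; apply: eq_bigr => j _ /=.
rewrite mulmxA -mulmxA -trmx_mul mxtrace_mulC vP !eqxx.
by rewrite mxtrace_scalar.
Qed.

Definition fproj := \sum_i munit i i.

Lemma tr_fproj : fproj^T = fproj.
Proof. by rewrite raddf_sum; apply: eq_bigr => i _; rewrite /= tr_munit. Qed.

Lemma fproj_frame k a : fproj *m (T k *m v a) = T k *m v a.
Proof.
rewrite mulmx_suml (bigD1 a) //= munit_frame eqxx scale1r big1 ?addr0 // => i ia.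
by rewrite munit_frame (negPf ia) scale0r.
Qed.

Lemma fproj_idem : fproj *m fproj = fproj.
Proof.
rewrite mulmx_suml; apply: eq_bigr => i _; rewrite mulmx_sumr (bigD1 i) //=.
rewrite munitM eqxx scale1r big1 ?addr0 // => j ji.
by rewrite munitM eq_sym (negPf ji) scale0r.
Qed.

Lemma trace_fproj : \tr fproj = (d * #|I|)%:R.
Proof.
rewrite raddf_sum (eq_bigr (fun=> d%:R)) => [|i _]; last exact: trace_munit.
by rewrite sumr_const -mulrnA.
Qed.

Lemma fproj_commute k : T k *m fproj = fproj *m T k.
Proof.
by rewrite mulmx_sumr mulmx_suml; apply: eq_bigr => i _; rewrite munit_commute.
Qed.

(** [1%:M - fproj] is a symmetric idempotent, so its trace is the sum of the squares of its entries;
    the dimension count makes this trace 0. *)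
Lemma fproj_full : m = (d * #|I|)%N -> fproj = 1%:M.
Proof.
move=> mE; apply/eqP; rewrite eq_sym -subr_eq0; apply/eqP/mxtrace_tr_mul_eq0.
have -> : (1%:M - fproj)^T *m (1%:M - fproj) = 1%:M - fproj.
  rewrite [(_ - _)^T]raddfB /= tr_scalar_mx tr_fproj mulmxBl mul1mx mulmxBr mulmx1 fproj_idem.
  by rewrite subrr subr0.
by rewrite raddfB /= mxtrace1 trace_fproj -mE subrr.
Qed.

Lemma twist_mulr_commute A X : (forall k, T k *m A = A *m T k) ->
  A *m twist X = twist (A *m X).
Proof.
move=> AT; rewrite mulmx_sumr; apply: eq_bigr => j _.
by rewrite !mulmxA AT.
Qed.

Section EigenFrame.
Variables (A : 'M[R]_m) (mu : I -> R).
Hypothesis AT : forall k, T k *m A = A *m T k.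
Hypothesis Av : forall i, A *m v i = mu i *: v i.

Lemma mul_fproj : A *m fproj = \sum_i mu i *: munit i i.
Proof.
rewrite mulmx_sumr; apply: eq_bigr => i _.
rewrite twist_mulr_commute // mulmxA Av -scalemxAl /munit /twist scaler_sumr.
by apply: eq_bigr => j _; rewrite -scalemxAr -scalemxAl.
Qed.

End EigenFrame.
End OrthoFrame.

(** The projection [Q] onto the frame commutes with [A], so its kernel is [A]-stable; the trace of
    [1%:M - Q] shows that it is nonzero. A unit eigenvector in it is orthogonal to the old frame,
    and so are its images under [T], because [Q] commutes with [T]. *)
Lemma orthoframe_extend k (v : 'I_k -> 'cV[R]_m) (A : 'M[R]_m) (mu : 'I_k -> R)
    (s : seq R) :
  orthoframe v -> A^T = A -> (forall k, T k *m A = A *m T k) ->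
  (forall i, A *m v i = mu i *: v i) ->
  char_poly A = \prod_(x <- s) ('X - x%:P) -> m <> (d * k)%N ->
  exists (v' : 'I_k.+1 -> 'cV[R]_m) (mu' : 'I_k.+1 -> R),
    orthoframe v' /\ forall i, A *m v' i = mu' i *: v' i.
Proof.
move=> vP At AT Av charA mk; pose Q := fproj v.
have AQ : A *m Q = Q *m A.
  have QA : A *m Q = \sum_i mu i *: munit v i i by rewrite (mul_fproj (mu := mu)).
  rewrite -[RHS]trmxK trmx_mul At tr_fproj QA raddf_sum; apply: eq_bigr => i _ /=.
  by rewrite linearZ /= tr_munit.
have QQ : Q *m Q = Q by exact: fproj_idem.
have Qn1 : 1%:M - Q != 0.
  apply/eqP => Q1; have : \tr (1%:M - Q) = 0 by rewrite Q1 raddf0.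
  rewrite raddfB /= mxtrace1 trace_fproj // card_ord => /eqP.
  by rewrite subr_eq0 eqr_nat => /eqP.
have [j0 wj0] : exists j, col j (1%:M - Q) != 0.
  apply/existsP; apply: contraNT Qn1 => /existsPn w0; apply/eqP/matrixP => i j.
  by have /negPn/eqP/matrixP/(_ i 0) := w0 j; rewrite !mxE.
have Qw : Q *m col j0 (1%:M - Q) = 0.
  by rewrite !colE mulmxA mulmxBr mulmx1 QQ subrr mul0mx.
have [x y|u [x [Qu u0 Au]]] := eigenvector_in_stable
    (P := fun w => Q *m w = 0) charA _ Qw wj0.
  by move=> Qy; rewrite mulmxBr -scalemxAr Qy scaler0 subr0 mulmxA -AQ -mulmxA Qy mulmx0.
pose n2 := \sum_i u i 0 ^+ 2.
have uu : u^T *m u = n2%:M.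
  apply/matrixP => a b; rewrite !ord1 !mxE eqxx mulr1n.
  by apply: eq_bigr => i _; rewrite mxE expr2.
have n20 : 0 < n2.
  rewrite lt_def sumr_ge0 ?andbT => [|i _]; last exact: sqr_ge0.
  apply: contraNneq u0 => /eqP; rewrite psumr_eq0 => [/allP u00|i _]; last exact: sqr_ge0.
  apply/eqP/matrixP => i b; rewrite ord1 mxE; apply/eqP.
  by have := u00 i (mem_index_enum _); rewrite /= sqrf_eq0.
pose c := (Num.sqrt n2)^-1; pose w := c *: u.
have ww : w^T *m w = 1%:M.
  rewrite /w [(c *: u)^T]linearZ /= -scalemxAl -scalemxAr scalerA uu scale_scalar_mx.
  by rewrite /c -invfM -expr2 sqr_sqrtr ?ltW // mulVf ?gt_eqF.
have Qw0 : Q *m w = 0 by rewrite /w -scalemxAr Qu scaler0.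
have frame_w j l : (T j *m w)^T *m (T l *m w) = (j == l)%:R%:M.
  rewrite trmx_mul -mulmxA [(T j)^T *m _]mulmxA.
  have [->|jl] := eqVneq j l; first by rewrite Torth mul1mx.
  apply/matrixP => a b; rewrite !ord1 [RHS]mxE /= mul0rn.
  (* A 1x1 matrix is its own transpose, so skewness of [(T j)^T *m T l] forces it to be 0. *)
  set X := w^T *m _; have : X^T = - X.
    by rewrite /X trmx_mul [(_ *m w)^T]trmx_mul trmxK Tskew // mulmxN mulNmx !mulmxA.
  move/matrixP/(_ 0 0); rewrite !mxE => X0; apply/eqP.
  have := X0; lra.
have frame_vw j l i : (T j *m v i)^T *m (T l *m w) = 0.
  rewrite -(fproj_frame vP) trmx_mul tr_fproj -mulmxA -/Q.
  by rewrite [Q *m _]mulmxA -fproj_commute // -mulmxA Qw0 !mulmx0.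
pose v' i := if unlift ord_max i is Some j then v j else w.
pose mu' i := if unlift ord_max i is Some j then mu j else x.
exists v', mu'; split=> [i l j j'|i]; last first.
  rewrite /v' /mu'; case: unliftP => [i' _|_] //.
  by rewrite /w -scalemxAr Au scalerA mulrC -scalerA.
rewrite /v'; case: (unliftP ord_max i) => [i' ->|->].
  case: (unliftP ord_max l) => [l' ->|->].
    by rewrite vP (inj_eq lift_inj).
  by rewrite frame_vw eq_sym (negPf (neq_lift _ _)) raddf0.
case: (unliftP ord_max l) => [l' ->|->]; last by rewrite frame_w eqxx.
rewrite (negPf (neq_lift _ _)) raddf0 -[LHS]trmxK trmx_mul trmxK.
by rewrite frame_vw raddf0.
Qed.

Lemma spectral_orthoframe n (A : 'M[R]_m) (s : seq R) :
  (0 < d)%N -> m = (d * n)%N -> A^T = A -> (forall k, T k *m A = A *m T k) ->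
  char_poly A = \prod_(x <- s) ('X - x%:P) ->
  exists (v : 'I_n -> 'cV[R]_m) (mu : 'I_n -> R),
    orthoframe v /\ forall i, A *m v i = mu i *: v i.
Proof.
move=> d0 mE At AT charA; suff : forall k, (k <= n)%N ->
    exists (v : 'I_k -> 'cV[R]_m) (mu : 'I_k -> R),
    orthoframe v /\ forall i, A *m v i = mu i *: v i by apply.
elim=> [_|k IH kn]; first by exists (fun=> 0), (fun=> 0); split => [[]|[]].
have [v [mu [vP Av]]] := IH (ltnW kn).
apply: (orthoframe_extend vP At AT Av charA) => /eqP.
by rewrite mE eqn_pmul2l // gtn_eqF.
Qed.

(** For each [i] the quadratic form of [munit v i i] is a sum of squares at [w]; together these
    forms add up to the squared norm of [w], so not all of them vanish. *)
Lemma posdef_frame_sum n (v : 'I_n -> 'cV[R]_m) (x : 'I_n -> R) (w : 'cV[R]_m) :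
  orthoframe v -> m = (d * n)%N -> (forall i, 0 < x i) -> w != 0 ->
  0 < (w^T *m (\sum_i x i *: munit v i i) *m w) 0 0.
Proof.
move=> vP mE x0 w0.
pose q i := (w^T *m munit v i i *m w) 0 0.
have q0 i : 0 <= q i.
  rewrite /q /munit /twist mulmx_sumr mulmx_suml summxE sumr_ge0 // => j _.
  set t := v i; have -> : w^T *m (T j *m (t *m t^T) *m (T j)^T) *m w
      = (w^T *m (T j *m t)) *m (w^T *m (T j *m t))^T.
    by rewrite !trmx_mul trmxK !mulmxA.
  by set b := w^T *m _; rewrite mxE big_ord1 [b^T _ _]mxE -expr2 sqr_ge0.
have qs : 0 < \sum_i q i.
  rewrite -summxE -mulmx_suml -mulmx_sumr -/(fproj v) (fproj_full vP) ?card_ord // mulmx1.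
  rewrite mxE (eq_bigr (fun i => w i 0 ^+ 2)) => [|i _]; last by rewrite mxE expr2.
  rewrite lt_def sumr_ge0 ?andbT => [|i _]; last exact: sqr_ge0.
  apply: contraNneq w0 => /eqP; rewrite psumr_eq0 => [/allP w00|i _]; last exact: sqr_ge0.
  apply/eqP/matrixP => i b; rewrite ord1 mxE; apply/eqP.
  by have := w00 i (mem_index_enum _); rewrite /= sqrf_eq0.
have -> : (w^T *m (\sum_i x i *: munit v i i) *m w) 0 0 = \sum_i x i * q i.
  rewrite mulmx_sumr mulmx_suml summxE; apply: eq_bigr => i _.
  by rewrite -scalemxAr -scalemxAl mxE.
rewrite lt_def sumr_ge0 ?andbT => [|i _]; last by rewrite mulr_ge0 // ltW.
apply: contraTneq qs => /eqP; rewrite psumr_eq0 => [/allP xq|i _]; last by rewrite mulr_ge0 // ltW.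
rewrite big1 ?ltxx // => i _; apply/eqP; have := xq i (mem_index_enum _).
by rewrite /= mulf_eq0 gt_eqF.
Qed.

(** The permutation matrix of [s] in a K-frame: it carries the K-line of [v i] to that of
    [v (s i)]. *)
Definition frame_perm n (v : 'I_n -> 'cV[R]_m) (s : 'S_n) :=
  \sum_i munit v (s i) i.

Lemma frame_permP n (v : 'I_n -> 'cV[R]_m) (s : 'S_n) (x : 'I_n -> R) :
  orthoframe v ->
  frame_perm v s *m (\sum_i x i *: munit v i i) *m (frame_perm v s)^T
    = \sum_i x i *: munit v (s i) (s i).
Proof.
move=> vP; rewrite /frame_perm [(\sum_i _)^T]raddf_sum /=.
have -> : (\sum_i munit v (s i) i) *m (\sum_i x i *: munit v i i)
    = \sum_i x i *: munit v (s i) i.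
  rewrite mulmx_suml; apply: eq_bigr => i _; rewrite mulmx_sumr (bigD1 i) //=.
  rewrite -scalemxAr munitM // eqxx scale1r big1 ?addr0 // => j ji.
  by rewrite -scalemxAr munitM // eq_sym (negPf ji) scale0r scaler0.
rewrite mulmx_suml; apply: eq_bigr => i _; rewrite mulmx_sumr (bigD1 i) //=.
rewrite tr_munit -scalemxAl munitM // eqxx scale1r big1 ?addr0 // => j ji.
by rewrite tr_munit -scalemxAl munitM // eq_sym (negPf ji) scale0r scaler0.
Qed.

Lemma frame_perm_commute n (v : 'I_n -> 'cV[R]_m) (s : 'S_n) k :
  T k *m frame_perm v s = frame_perm v s *m T k.
Proof.
by rewrite mulmx_sumr mulmx_suml; apply: eq_bigr => i _; rewrite munit_commute.
Qed.

Lemma frame_perm_orthogonal n (v : 'I_n -> 'cV[R]_m) (s : 'S_n) :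
  orthoframe v -> m = (d * n)%N -> frame_perm v s *m (frame_perm v s)^T = 1%:M.
Proof.
move=> vP mE; have v1 : \sum_i 1 *: munit v i i = 1%:M.
  rewrite -(fproj_full vP) ?card_ord //.
  by apply: eq_bigr => i _; rewrite scale1r.
rewrite -[X in X *m _]mulmx1 -v1 frame_permP // v1.
by rewrite -[RHS]v1 [RHS](reindex_inj (@perm_inj _ s)).
Qed.

End Frame.

(** The columns [T j *m v i] form an orthogonal matrix [V] diagonalizing [A], with each [mu i]
    repeated [d] times. Through determinants, [mu] need not be matched entry by entry with a given
    list of eigenvalues. *)
Lemma det_orthoframe (R : rcfType) d n (T : 'I_d -> 'M[R]_(d * n))
    (v : 'I_n -> 'cV[R]_(d * n)) (A : 'M[R]_(d * n)) (mu : 'I_n -> R) :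
  orthoframe T v -> (forall k, T k *m A = A *m T k) ->
  (forall i, A *m v i = mu i *: v i) -> \det A = (\prod_i mu i) ^+ d.
Proof.
move=> vP AT Av.
pose V := \matrix_(a, c) mxvec (\matrix_(j, i) (T j *m v i) a 0) 0 c.
have VE a j i : V a (mxvec_index j i) = (T j *m v i) a 0 by rewrite mxE mxvecE mxE.
pose D : 'rV[R]_(d * n) := mxvec (\matrix_(j, i) mu i).
have idx_inj j i j' i' : (mxvec_index j i == mxvec_index j' i' :> 'I_(d * n))
    = (i == i') && (j == j').
  have [g gK _] := @curry_mxvec_bij d n.
  apply/eqP/andP => [E|[/eqP-> /eqP->] //].
  by have := congr1 g E; rewrite -![mxvec_index _ _]/(uncurry _ (_, _)) !gK // => -[-> ->].
have VV : V^T *m V = 1%:M.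
  apply/matrixP => c c'; case/mxvec_indexP: c => j i; case/mxvec_indexP: c' => j' i'.
  have E : ((T j *m v i)^T *m (T j' *m v i')) 0 0 = ((i == i') && (j == j'))%:R.
    by rewrite vP mxE eqxx mulr1n.
  rewrite [RHS]mxE idx_inj -E !mxE; apply: eq_bigr => a _.
  by rewrite [V^T _ _]mxE !VE [in RHS]mxE.
have AV : A *m V = V *m diag_mx D.
  apply/matrixP => a c; case/mxvec_indexP: c => j i.
  have AE : (A *m (T j *m v i)) a 0 = mu i * (T j *m v i) a 0.
    by rewrite mulmxA -AT -mulmxA Av -scalemxAr mxE.
  rewrite mul_mx_diag [RHS]mxE VE mxvecE [X in _ * X]mxE mulrC -AE !mxE.
  by apply: eq_bigr => b _; rewrite VE.
have dV : \det V != 0.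
  have := congr1 determinant VV; rewrite det_mulmx det1 det_tr => /eqP.
  by apply: contraTneq => ->; rewrite mul0r eq_sym oner_eq0.
have := congr1 determinant AV; rewrite !det_mulmx mulrC => /(mulfI dV) ->.
rewrite det_diag /D.
transitivity (\prod_(j < d) \prod_i mu i); last by rewrite prodr_const card_ord.
rewrite pair_big (reindex _ (curry_mxvec_bij _ _)) /=.
by apply: eq_big => [[j i]|[j i] _] //=; rewrite mxvecE mxE.
Qed.

(** * The frames attached to R, C and H *)

Section KFrame.
Variables (R : rcfType) (m : nat).

Definition isframe d (T : 'I_d -> 'M[R]_m) :=
  [/\ forall j, (T j)^T *m T j = 1%:M,
      forall j k, j != k -> ((T j)^T *m T k)^T = - ((T j)^T *m T k)
    & forall k X, T k *m twist T X = twist T X *m T k].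

(** Index 0 is the identity. When [d = (size Js).+1] the default value of [nth] is never reached. *)
Definition frame_of d (Js : seq 'M[R]_m) (j : 'I_d) : 'M[R]_m := nth 1%:M (1%:M :: Js) j.

Lemma isframe_real : isframe (@frame_of 1 [::]).
Proof.
split=> [j|j k|k X]; rewrite ?ord1 /frame_of /= ?trmx1 ?mul1mx //.
by rewrite mulmx1.
Qed.

Lemma isframe_complex (J : 'M[R]_m) :
  J *m J = - 1%:M -> J^T = - J -> isframe (@frame_of 2 [:: J]).
Proof.
move=> JJ JT; split=> [j|j k|k X].
- by case: j => [[|[|]]] //= ?; rewrite /frame_of /= ?trmx1 ?mul1mx // JT mulNmx JJ opprK.
- by case: j => [[|[|]]] //= ?; case: k => [[|[|]]] //= ? _;
    rewrite /frame_of /= ?trmx_mul ?trmxK ?trmx1 ?mul1mx ?mulmx1 ?JT ?opprK.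
rewrite /twist !big_ord_recl big_ord0 /= /frame_of /= addr0 trmx1 mul1mx mulmx1 JT.
case: k => [[|[|]]] //= ?; first by rewrite mul1mx mulmx1.
rewrite !mulmxDr !mulmxDl !mulmxN !mulNmx !mulmxA JJ -[X in _ = _ - X]mulmxA JJ.
by rewrite mulmxN mulmx1 !mulNmx mul1mx !opprK addrC.
Qed.

(** The relations and transposition give the whole multiplication table. With it, multiplying
    [twist X] by [T k] on the left and on the right expands into the same four terms. *)
Lemma isframe_quaternion (I J K : 'M[R]_m) :
  I *m I = - 1%:M -> J *m J = - 1%:M -> K *m K = - 1%:M -> I *m J *m K = - 1%:M ->
  I^T = - I -> J^T = - J -> K^T = - K -> isframe (@frame_of 4 [:: I; J; K]).
Proof.
move=> II JJ KK IJK IT JT KT.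
have IJ : I *m J = K.
  by rewrite -[LHS]mulmx1 -[1%:M]opprK -KK mulmxN mulmxA IJK mulNmx mul1mx opprK.
have JI : J *m I = - K by rewrite -KT -IJ trmx_mul IT JT mulNmx mulmxN opprK.
have JK : J *m K = I by rewrite -IJ mulmxA JI mulNmx -IJ -mulmxA JJ mulmxN mulmx1 opprK.
have KJ : K *m J = - I by rewrite -IT -JK trmx_mul KT JT mulNmx mulmxN opprK.
have IK : I *m K = - J by rewrite -IJ mulmxA II mulNmx mul1mx.
have KI : K *m I = J.
  by rewrite -[RHS]opprK -JT -[J]opprK -IK raddfN /= trmx_mul IT KT mulNmx mulmxN !opprK.
split=> [j|j k|k X].
- by case: j => [[|[|[|[|]]]]] //= ?; rewrite /frame_of /= ?trmx1 ?mul1mx //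
    ?IT ?JT ?KT mulNmx ?II ?JJ ?KK opprK.
- by case: j => [[|[|[|[|]]]]] //= ?; case: k => [[|[|[|[|]]]]] //= ? _;
    rewrite /frame_of /= ?trmx1 ?mul1mx ?mulmx1 ?trmxK ?IT ?JT ?KT ?opprK // ?mulNmx
      ?IJ ?JI ?JK ?KJ ?IK ?KI ?opprK ?raddfN /= ?IT ?JT ?KT ?opprK.
have R2 (Y A B C : 'M[R]_m) : A *m B = C -> Y *m A *m B = Y *m C.
  by move=> <-; rewrite mulmxA.
rewrite /twist !big_ord_recl big_ord0 /= /frame_of /= addr0 trmx1 mul1mx mulmx1 IT JT KT.
case: k => [[|[|[|[|]]]]] //= ?; first by rewrite mul1mx mulmx1.
all: rewrite !mulmxDr !mulmxDl !mulmxN !mulNmx !mulmxA.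
- rewrite II IJ IK (R2 _ _ _ _ II) (R2 _ _ _ _ JI) (R2 _ _ _ _ KI).
  rewrite !(mulmxN, mulNmx, mulmx1, mul1mx, opprK).
  by rewrite addrCA [- _ + _]addrC.
- rewrite JJ JI JK (R2 _ _ _ _ JJ) (R2 _ _ _ _ IJ) (R2 _ _ _ _ KJ).
  rewrite !(mulmxN, mulNmx, mulmx1, mul1mx, opprK).
  by rewrite addrA addrC -addrA.
- rewrite KK KI KJ (R2 _ _ _ _ KK) (R2 _ _ _ _ IK) (R2 _ _ _ _ JK).
  rewrite !(mulmxN, mulNmx, mulmx1, mul1mx, opprK).
  by rewrite addrC [_ + (_ + X *m K)]addrC [_ + X *m K]addrC -!addrA.
Qed.

End KFrame.

Lemma Kstructure_frame (R : realType) K m (Js : seq 'M[R]_m) :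
  Kstructure K Js -> isframe (@frame_of R m (Kdim K) Js) /\ size Js = (Kdim K).-1.
Proof.
case: K => /=.
- by move=> ->; split => //; apply: isframe_real.
- by move=> [J [-> [JJ JT]]]; split => //; apply: isframe_complex.
move=> [I [J [K [-> [II [JJ [KK [IJK [IT [JT KT]]]]]]]]]]; split => //.
exact: isframe_quaternion.
Qed.

(** * Positivity on the Garding cone *)

Local Open Scope classical_set_scope.

(** Both [P] and its complement are open, and the line is connected. *)
Lemma locally_constant_real (R : realType) (P : R -> Prop) :
  (forall s0, exists2 d, 0 < d & forall s, `|s - s0| < d -> (P s <-> P s0)) ->
  forall a b, P a -> P b.
Proof.
move=> lc a b Pa.
have oP (Q : R -> Prop) :
    (forall s0, exists2 d, 0 < d & forall s, `|s - s0| < d -> (Q s <-> Q s0)) ->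
    open [set s | Q s].
  move=> lcQ; rewrite openE => s0 /= Qs0; have [d d0 dQ] := lcQ s0.
  by exists d => //= s; rewrite /= distrC => /dQ [_]; apply.
have cT : connected [set: R] by apply/connected_intervalP => x y.
suff E : [set s | P s] = setT by have : [set s | P s] b by rewrite E.
apply: cT; first by exists a.
  by exists [set s | P s]; rewrite ?setTI //; apply: oP.
exists [set s | P s]; rewrite ?setTI // -openC; apply: (oP (fun s => ~ P s)) => s0.
have [d d0 dP] := lc s0; exists d => // s /dP [PQ QP].
by split=> nP Ps; apply: nP; [exact: QP|exact: PQ].
Qed.

Lemma meval_continuous (R : realType) m (p : mpoly.mpoly (m * m) R) :
  continuous (fun A : 'M[R]_m => mpoly.meval (fun i => mxvec A 0 i) p).
Proof.
have sumC (I : Type) (s : seq I) (F : I -> 'M[R]_m -> R) :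
    (forall i, continuous (F i)) -> continuous (fun A => \sum_(i <- s) F i A).
  move=> Fc A0; elim: s => [|i s IH].
    by under eq_fun do rewrite big_nil; apply: cst_continuous.
  by under eq_fun do rewrite big_cons; apply: continuousD => //; apply: Fc.
have prodC (I : Type) (s : seq I) (F : I -> 'M[R]_m -> R) :
    (forall i, continuous (F i)) -> continuous (fun A => \prod_(i <- s) F i A).
  move=> Fc A0; elim: s => [|i s IH].
    by under eq_fun do rewrite big_nil; apply: cst_continuous.
  by under eq_fun do rewrite big_cons; apply: continuousM => //; apply: Fc.
under eq_fun do rewrite mpoly.mevalE.
apply: sumC => mm A0; apply: continuousM; first exact: cst_continuous.
move: A0; apply: prodC => i A0.
apply: (continuous_comp (f := fun A : 'M[R]_m => mxvec A 0 i) (g := fun x => x ^+ _)).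
  case/mxvec_indexP: i => a b.
  have -> : (fun A : 'M[R]_m => mxvec A 0 (mxvec_index a b)) = (fun A => A a b).
    by apply/funext => A; rewrite mxvecE.
  exact: coord_continuous.
exact: exprn_continuous.
Qed.

(** The image of the connected cone under [F] is an interval that misses 0 and contains [F 1%:M]. *)
Lemma garding_cone_pos (R : realType) m (Js : seq 'M[R]_m) N (F : 'M[R]_m -> R) A :
  homog_poly_on Js N F -> 0 < F 1%:M -> garding_cone Js F A -> 0 < F A.
Proof.
move=> [p [_ Fp]] F1 FA.
have cS := @component_connected _ [set A | SK Js A /\ F A != 0] 1%:M.
have sub := @connected_component_sub _ [set A | SK Js A /\ F A != 0] 1%:M.
(* [F] is polynomial only on [SK Js]; continuity is taken from [G], which agrees with it there. *)
pose G := fun B : 'M[R]_m => mpoly.meval (fun i => mxvec B 0 i) p.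
have : connected (G @` garding_cone Js F).
  apply: connected_continuous_connected => //.
  exact/continuous_subspaceT/meval_continuous.
have FG B : garding_cone Js F B -> F B = G B by move=> /sub [/Fp].
have in1 : garding_cone Js F 1%:M.
  apply: connected_component_refl; split; last by rewrite gt_eqF.
  by split=> [|J _]; rewrite ?trmx1 ?mul1mx ?mulmx1.
move=> /connected_intervalP itv; rewrite ltNge; apply/negP => FA0.
have [B gB GB0] : (G @` garding_cone Js F) 0.
  apply: (itv (F A) (F 1%:M)); last by rewrite FA0 ltW.
    by exists A => //; rewrite FG.
  by exists 1%:M => //; rewrite FG.
by have [_] := sub _ gB; rewrite FG // GB0 eqxx.
Qed.

Local Close Scope classical_set_scope.

(** * Lower bounds for symmetric sums of monomials *)

Lemma ln_prod (R : realType) (I : Type) (s : seq I) (x : I -> R) :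
  (forall i, 0 < x i) -> ln (\prod_(i <- s) x i) = \sum_(i <- s) ln (x i).
Proof.
move=> x0; elim: s => [|i s IH]; first by rewrite !big_nil ln1.
by rewrite !big_cons lnM ?IH // posrE ?prodr_gt0.
Qed.

(* Jensen's inequality for [exp] with weights [a m / f 1], in the coordinates [ln (x i)]. *)
Lemma monomial_sum_bound (R : realType) n (I : eqType) (s : seq I) (a : I -> R)
    (e : I -> 'I_n -> nat) N (f : ('I_n -> R) -> R) :
  (forall x, f x = \sum_(m <- s) a m * \prod_i x i ^+ e m i) ->
  {in s, forall m, 0 <= a m /\ (\sum_i e m i)%N = N} -> 0 < f (fun=> 1) ->
  exists2 c : 'I_n -> R, \sum_i c i = N%:R &
    forall x, (forall i, 0 < x i) ->
      ln (f (fun=> 1)) + \sum_i c i * ln (x i) <= ln (f x).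
Proof.
move=> fE sP f1; set v := f _ in f1 *.
have vE : v = \sum_(m <- s) a m.
  rewrite /v fE; apply: eq_bigr => m _.
  by rewrite big1 ?mulr1 // => i _; rewrite expr1n.
(* The mean exponent of [x i], that is, the partial derivative of [ln f] with respect to [ln (x i)]
   at (1, ..., 1). *)
exists (fun i => (\sum_(m <- s) a m * (e m i)%:R) / v).
  have vN : \sum_i \sum_(m <- s) a m * (e m i)%:R = v * N%:R.
    rewrite exchange_big vE mulr_suml; apply: eq_big_seq => m /sP [_ <-].
    by rewrite -mulr_sumr natr_sum.
  by rewrite -mulr_suml vN mulrAC divff ?mul1r ?lt0r_neq0.
have v0 : v != 0 by rewrite lt0r_neq0.
move=> x x0; pose y m := \sum_i (e m i)%:R * ln (x i).
pose L := \sum_i (\sum_(m <- s) a m * (e m i)%:R) / v * ln (x i).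
have LE : v * L = \sum_(m <- s) a m * y m.
  rewrite mulr_sumr (eq_bigr (fun i => \sum_(m <- s) a m * (e m i)%:R * ln (x i))).
    rewrite exchange_big; apply: eq_bigr => m _; rewrite mulr_sumr.
    by apply: eq_bigr => i _; rewrite mulrA.
  by move=> i _; rewrite mulrA [v * _]mulrC divfK // mulr_suml.
have fy : f x = \sum_(m <- s) a m * expR (y m).
  rewrite fE; apply: eq_bigr => m _; congr (_ * _); rewrite expR_sum.
  by apply: eq_bigr => i _; rewrite expRM_natl lnK // posrE.
(* Tangent line of [expR] at [L]: the terms [a m * (y m - L)] sum to 0, because [L] is the weighted
   mean of the [y m]. *)
have fx : v * expR L <= f x.
  have -> : v * expR L = \sum_(m <- s) a m * (expR L * (1 + (y m - L))).
    rewrite (eq_bigr (fun m => expR L * (a m * (1 - L) + a m * y m))) => [|m _]; last by ring.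
    by rewrite -mulr_sumr big_split /= -mulr_suml -vE -LE; ring.
  rewrite fy !big_seq ler_sum // => m /sP [am _]; rewrite ler_wpM2l //.
  rewrite -[X in _ <= expR X](subrK L) expRD [X in X <= _]mulrC.
  by rewrite ler_pM2r ?expR_gt0 ?expR_ge1Dx.
rewrite -/L -[L in _ + L]expRK -lnM ?posrE ?expR_gt0 //.
by rewrite ler_ln ?posrE ?mulr_gt0 ?expR_gt0 // (lt_le_trans _ fx) // mulr_gt0 ?expR_gt0.
Qed.

(** Over all cyclic shifts each [ln (x i)] meets every [c j] exactly once, so only the sum of [c]
    survives. *)
Lemma symmetric_bound (R : realType) n N (c : 'I_n -> R) (f : ('I_n -> R) -> R) :
  (0 < n)%N -> \sum_i c i = N%:R ->
  (forall x, (forall i, 0 < x i) ->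
      ln (f (fun=> 1)) + \sum_i c i * ln (x i) <= ln (f x)) ->
  (forall (s : 'S_n) x, f (x \o s) = f x) ->
  forall x, (forall i, 0 < x i) ->
    n%:R * ln (f (fun=> 1)) + N%:R * \sum_i ln (x i) <= n%:R * ln (f x).
Proof.
case: n c f => // n c f _ cN fc fsym x x0.
have : \sum_(k < n.+1) (ln (f (fun=> 1)) + \sum_i c i * ln (x (i + k)))
    <= \sum_(k < n.+1) ln (f x).
  apply: ler_sum => k _; rewrite -(fsym (perm (addIr k)) x).
  apply: le_trans (fc _ _) => [|i]; last exact: x0.
  by rewrite lerD2l ler_sum // => i _; rewrite /= permE.
rewrite big_split /= !sumr_const card_ord -[ln _ *+ _]mulr_natl -[ln (f x) *+ _]mulr_natl.
suff -> : \sum_(k < n.+1) \sum_i c i * ln (x (i + k)) = N%:R * \sum_i ln (x i) by [].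
rewrite exchange_big -cN mulr_suml; apply: eq_bigr => i _; rewrite -mulr_sumr.
by rewrite [in RHS](reindex_inj (addrI i)).
Qed.

(** * The restriction of F to diagonal matrices *)

Section Diagonal.
Variables (R : realType) (K : Kfield) (n N : nat).
Let m := (Kdim K * n)%N.
Variables (Js : seq 'M[R]_m) (F : 'M[R]_m -> R).
Hypothesis KJs : Kstructure K Js.
Let T := @frame_of R m (Kdim K) Js.
Variable v : 'I_n -> 'cV[R]_m.
Hypothesis vP : orthoframe T v.

Definition fdiag (x : 'I_n -> R) := \sum_i x i *: munit T v i i.

Lemma commute_frame_mem (A : 'M[R]_m) :
  (forall k, T k *m A = A *m T k) <-> (forall J, J \in Js -> A *m J = J *m A).
Proof.
have [_ szJ] := Kstructure_frame KJs.
have K0 : Kdim K = (Kdim K).-1.+1 by case: (K).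
split=> [AT J|AJ k].
  move=> /(nthP 1%:M)[i iJ <-]; rewrite szJ in iJ.
  have iK : (i.+1 < Kdim K)%N by rewrite K0.
  exact: esym (AT (Ordinal iK)).
rewrite /T /frame_of; case: k => [[|k] kK] /=; first by rewrite mul1mx mulmx1.
by rewrite AJ // mem_nth // szJ -ltnS -K0.
Qed.

Lemma fdiag_SK x : SK Js (fdiag x).
Proof.
have [[_ _ Tt] _] := Kstructure_frame KJs.
split; last apply/commute_frame_mem => k.
  by rewrite /fdiag [LHS]raddf_sum; apply: eq_bigr => i _; rewrite /= linearZ /= tr_munit.
rewrite /fdiag mulmx_sumr mulmx_suml; apply: eq_bigr => i _.
by rewrite -scalemxAr -scalemxAl munit_commute.
Qed.

Lemma fdiag1 : fdiag (fun=> 1) = 1%:M.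
Proof.
rewrite -(fproj_full vP) ?card_ord //.
by apply: eq_bigr => i _; rewrite scale1r.
Qed.

Lemma fdiag_shift t x : fdiag (fun i => t + x i) = t%:M + fdiag x.
Proof.
rewrite -[t%:M]scalemx1 -fdiag1 /fdiag scaler_sumr -big_split /=.
by apply: eq_bigr => i _; rewrite scalerDl scale1r.
Qed.

Lemma fdiag_posdef x : (forall i, 0 < x i) -> posdef (fdiag x).
Proof.
by move=> x0; split=> [|w w0]; [case: (fdiag_SK x) | apply: posdef_frame_sum].
Qed.

Lemma fdiag_perm (s : 'S_n) x : Kinvariant K Js F ->
  F (fdiag (x \o s)) = F (fdiag x).
Proof.
have [[_ _ Tt] szJ] := Kstructure_frame KJs => Finv.
pose u := frame_perm T v s.
have uu : u *m u^T = 1%:M by apply: frame_perm_orthogonal.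
have uJ J : J \in Js -> u *m J = J *m u.
  by move: J; apply/commute_frame_mem => k; apply: frame_perm_commute.
have uK : Kgroup K Js u.
  (* In the quaternionic case the Sp(1) factor is taken to be 1. *)
  move: uu uJ; case: (K) => // uu uJ; exists u, 1, 0, 0, 0; split => //; split.
    by rewrite !expr0n expr1n !addr0.
  by rewrite !scale0r !addr0 mulmx1.
rewrite -(Finv u _ uK (fdiag_SK _)) frame_permP //; congr F.
by rewrite /fdiag [RHS](reindex_inj (@perm_inj _ s)).
Qed.

End Diagonal.

(** * Eigenvalues of positive definite matrices and the final inequality *)

Lemma posdef_eigenvalue_gt0 (R : realType) m (A : 'M[R]_m) (x : R) :
  posdef A -> root (char_poly A) x -> 0 < x.
Proof.
move=> [At Apos]; rewrite -eigenvalue_root_char => /eigenvalueP[w wA w0].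
have wt0 : w^T != 0 by rewrite trmx_eq0.
have w20 : 0 < (w *m w^T) 0 0.
  rewrite mxE (eq_bigr (fun i => w 0 i ^+ 2)) => [|i _]; last by rewrite mxE expr2.
  rewrite lt_def sumr_ge0 ?andbT => [|i _]; last exact: sqr_ge0.
  apply: contraNneq w0 => /eqP; rewrite psumr_eq0 => [/allP w00|i _]; last exact: sqr_ge0.
  apply/eqP/matrixP => b i; rewrite ord1 mxE; apply/eqP.
  by have := w00 i (mem_index_enum _); rewrite /= sqrf_eq0.
by have := Apos _ wt0; rewrite trmxK wA -scalemxAl mxE pmulr_lgt0.
Qed.

Lemma prodrN_seq (R : comNzRingType) (s : seq R) :
  \prod_(x <- s) - x = (-1) ^+ size s * \prod_(x <- s) x.
Proof.
elim: s => [|x s IH]; first by rewrite !big_nil mulr1.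
by rewrite !big_cons IH /= exprS; ring.
Qed.

Theorem theorem4p5 (R : realType) (K : Kfield) (n N : nat)
    (Js : seq 'M[R]_(Kdim K * n)) (F : 'M[R]_(Kdim K * n) -> R) :
  (0 < n)%N -> (0 < N)%N ->
  Kstructure K Js -> GardingDirichlet Js N F -> Kinvariant K Js F ->
  forall (A : 'M[R]_(Kdim K * n)) (s : seq R),
    SK Js A -> posdef A -> Keigenvalues A s ->
    F 1%:M `^ (N%:R^-1) * (\prod_(x <- s) x) `^ (n%:R^-1)
      <= F A `^ (N%:R^-1).
Proof.
move=> n0 N0 KJs [Fhom F1 Froot Fcone] Finv A s [At AJ] Apos [szs charA].
have [[Torth Tskew Ttwist] szJ] := Kstructure_frame KJs.
have K0 : (0 < Kdim K)%N by case: (K).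
have AT := (commute_frame_mem KJs A).2 AJ.
(* The spectral lemma takes a list of linear factors, so each K-eigenvalue is repeated [Kdim K]
   times. *)
have charA' : char_poly A = \prod_(x <- flatten (nseq (Kdim K) s)) ('X - x%:P).
  by rewrite prod_flatten_nseq.
have [v [mu [vP Av]]] := spectral_orthoframe Torth Tskew Ttwist K0 erefl At AT charA'.
have AE : A = fdiag Js v mu.
  by rewrite -[LHS]mulmx1 -(fproj_full vP) ?card_ord // (mul_fproj AT Av).
have mu0 i : 0 < mu i.
  have vv : (v i)^T *m v i = 1%:M.
    have /(_ i i (Ordinal K0) (Ordinal K0)) := vP; rewrite !eqxx /frame_of /= !mul1mx.
    by rewrite mulr1n.
  have vi0 : v i != 0.
    apply/eqP => vi; have /matrixP/(_ 0 0)/eqP := vv.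
    by rewrite vi mulmx0 !mxE eqxx mulr1n eq_sym oner_eq0.
  have := Apos.2 _ vi0; rewrite -mulmxA Av -scalemxAr vv.
  by rewrite !mxE eqxx mulr1n mulr1.
have s0 : {in s, forall x, 0 < x}.
  move=> x xs; apply: (posdef_eigenvalue_gt0 Apos).
  by rewrite charA /root horner_exp expf_eq0 K0 -/(root _ _) root_prod_XsubC xs.
have ps0 : 0 < \prod_(x <- s) x.
  by rewrite big_seq prodr_gt0.
(* Both products are positive and have [\det A] as their [Kdim K]-th power, so they agree. *)
have pE : \prod_(x <- s) x = \prod_i mu i.
  have := det_orthoframe vP AT Av; have := char_poly_det A.
  rewrite charA -horner_coef0 horner_exp horner_prod.
  rewrite (eq_bigr (fun x => - x)) => [Es Em|x _]; last by rewrite hornerXsubC sub0r.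
  have {Es} : (\prod_(x <- s) x) ^+ Kdim K = (\prod_i mu i) ^+ Kdim K.
    have sg : (-1) ^+ (Kdim K * n) != 0 :> R by rewrite signr_eq0.
    rewrite -Em; apply: (mulfI sg).
    by rewrite -Es prodrN_seq szs exprMn -exprM mulnC.
  move/eqP; rewrite eqrXn2 // ?ltW // => [/eqP //|].
  by rewrite prodr_gt0.
have [p [pN Fp]] := Fhom.
have [f fN fE] := Hurwitz.linear_substitution
  (fun j i => mxvec (munit (@frame_of R _ (Kdim K) Js) v i i) 0 j) pN.
have fF x : mpoly.meval x f = F (fdiag Js v x).
  rewrite fE Fp; last exact: fdiag_SK.
  apply: mpoly.meval_eq => j; rewrite /fdiag raddf_sum summxE.
  by apply: eq_bigr => i _; rewrite /= linearZ /= mxE.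
have fpos : Hurwitz.orthant_pos f.
  move=> x x0; rewrite fF; apply: (garding_cone_pos Fhom F1).
  by apply: Fcone; [apply: fdiag_SK|apply: fdiag_posdef].
have froot (x : 'I_n -> R) : exists (c : R) (r : seq R),
    forall t, mpoly.meval (fun i => t + x i) f = c * \prod_(r <- r) (t - r).
  have [c [r fr]] := Froot _ (fdiag_SK KJs v x); exists c, r => t.
  by rewrite fF fdiag_shift // fr.
have [I [t [a [e [ft tP]]]]] :=
  Hurwitz.real_rooted_monomials (@locally_constant_real R) fN fpos froot.
have f1 : F 1%:M = mpoly.meval (fun=> 1) f by rewrite fF fdiag1.
have [|c cN fc] := monomial_sum_bound (f := fun x => mpoly.meval x f) ft tP.
  by rewrite -f1.
have fsym (g : 'S_n) x : mpoly.meval (x \o g) f = mpoly.meval x f.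
  by rewrite !fF; apply: fdiag_perm.
have FA0 : 0 < F A by rewrite AE -fF fpos.
have := symmetric_bound (f := fun x => mpoly.meval x f) n0 cN fc fsym mu0.
rewrite -f1 fF -AE => bound.
have n0' : 0 < n%:R :> R by rewrite ltr0n.
have N0' : 0 < N%:R :> R by rewrite ltr0n.
(* Taking logarithms and multiplying by [n%:R * N%:R] turns the goal into [bound]. *)
rewrite -ler_ln ?posrE ?mulr_gt0 ?powR_gt0 // lnM ?posrE ?powR_gt0 // !ln_powR.
rewrite pE ln_prod // -(ler_pM2l (mulr_gt0 n0' N0')) mulrDr.
have canc (y : R) : n%:R * N%:R * (N%:R^-1 * y) = n%:R * y.
  by rewrite -mulrA mulVKf ?lt0r_neq0.
have canc' (y : R) : n%:R * N%:R * (n%:R^-1 * y) = N%:R * y.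
  by rewrite [n%:R * _]mulrC -mulrA mulVKf ?lt0r_neq0.
by rewrite !canc canc'.
Qed.
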